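(* Let $f:(0,+\infty)\to\mathbb{R}$ be an operator convex function, let $\rho,\sigma$ be quantum states, i.e. density matrices in $\mathbb{M}_n$, and let $V^\downarrow, W^\downarrow$ be $n\times n$ unitary matrices such that $V^{\downarrow *}\rho V^\downarrow=\lambda^\downarrow(\rho)$ and $W^{\downarrow *}\sigma W^\downarrow=\lambda^\downarrow(\sigma)$. Then $$\min_{U\in\mathbb{U}_n}\widehat{S}_f(\rho\|U^*\sigma U)=\widehat{S}_f\big(\lambda^\downarrow(\rho)\,\|\,\lambda^\downarrow(\sigma)\big),$$ and $$\arg\min_{U\in\mathbb{U}_n}\widehat{S}_f(\rho\|U^*\sigma U)=W^\downarrow V^{\downarrow *}.$$
   Context: $\mathbb{M}_n$ is the set of complex $n\times n$ matrices and $\mathbb{U}_n$ the set of $n\times n$ unitary matrices. A quantum state (density matrix) is a positive semidefinite $\rho\in\mathbb{M}_n$ with $\operatorname{Tr}\rho=1$. For positive semidefinite $A\in\mathbb{M}_n$, $\lambda^\downarrow(A)$ denotes the diagonal matrix $\operatorname{diag}(\lambda_1^\downarrow(A),\dots,\lambda_n^\downarrow(A))$ of the eigenvalues of $A$ in nonincreasing order. Unitaries $V^\downarrow,W^\downarrow$ as in the claim exist by the spectral theorem. Maximal quantum $f$-divergence: for positive definite $\rho,\sigma\in\mathbb{M}_n$, $$\widehat{S}_f(\rho\|\sigma):=\operatorname{Tr}\left[\sigma f\left(\sigma^{-1/2}\rho\,\sigma^{-1/2}\right)\right],$$ and for general positive semidefinite $\rho,\sigma\in\mathbb{M}_n$,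 $$\widehat{S}_f(\rho\|\sigma):=\lim_{\epsilon\downarrow 0}\widehat{S}_f(\rho+\epsilon I\|\sigma+\epsilon I),$$ where $I$ is the identity matrix. An operator convex $f$ on $(0,+\infty)$ has the integral representation $$f(x)=f(1)+f'(1)(x-1)+c(x-1)^2+\int_{[0,+\infty)}\frac{(x-1)^2}{x+s}\,d\lambda(s),$$ with $c\ge 0$ and $\lambda$ a positive measure on $[0,+\infty)$ with $\int_{[0,+\infty)}\frac{1}{1+s}\,d\lambda(s)<+\infty$. In terms of this representation, writing $R=\lambda^\downarrow(\rho)$ and $D=\lambda^\downarrow(\sigma)$, the quantity $\widehat{S}_f(\lambda^\downarrow(\rho)\|\lambda^\downarrow(\sigma))$ denotes $$f(1)+c\left[\operatorname{Tr}(R^2D^{-1})-1\right]+\int_{[0,+\infty)}\operatorname{Tr}\frac{D^{-1}R^2}{D^{-1}R+sI}\,d\lambda(s)-2\int_{[0,+\infty)}\operatorname{Tr}\frac{R}{D^{-1}R+sI}\,d\lambda(s)+\int_{[0,+\infty)}\operatorname{Tr}\frac{D}{D^{-1}R+sI}\,d\lambda(s),$$ where $\frac{A}{B}$ means $AB^{-1}$ for positive definite $B$, and for positive semidefinite $B$ it is understood by replacing $B$ with $B+\epsilon I$ and letting $\epsilon\downarrow 0$. *)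

(* Defs.v *)
From HB Require Import structures.
From mathcomp Require Import all_boot all_order all_algebra.
From mathcomp Require Import complex.
From mathcomp Require Import all_classical all_reals all_analysis.

Set Implicit Arguments.
Unset Strict Implicit.
Unset Printing Implicit Defensive.

Import Order.TTheory GRing.Theory Num.Theory.
Import numFieldNormedType.Exports.

Local Open Scope classical_set_scope.
Local Open Scope ring_scope.
Local Open Scope complex_scope.
Local Open Scope sesquilinear_scope.

Section Matrices.
Variable R : realType.
Implicit Type n : nat.

(* On [R[i]], [0 <= z] means that [z] is real and nonnegative. *)
Definition psdmx n (A : 'M[R[i]]_n) : Prop :=
  A \is hermsymmx /\ forall u : 'rV[R[i]]_n, 0 <= (u *m A *m u^t*) 0 0.

Definition posdefmx n (A : 'M[R[i]]_n) : Prop :=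
  A \is hermsymmx /\
  forall u : 'rV[R[i]]_n, u != 0 -> 0 < (u *m A *m u^t*) 0 0.

Definition density n (A : 'M[R[i]]_n) : Prop := psdmx A /\ \tr A = 1.

Definition loewner_le n (A B : 'M[R[i]]_n) : Prop := psdmx (B - A).

(* Functional calculus [f(A)], meaningful when [A] is Hermitian. *)
Definition mxfun n (f : R -> R) (A : 'M[R[i]]_n) : 'M[R[i]]_n :=
  (spectralmx A)^t* *m
  diag_mx (map_mx (fun z : R[i] => (f (complex.Re z))%:C) (spectral_diag A)) *m
  spectralmx A.

(* A function on (0, +oo) is a total function [R -> R] of which only the values
   on (0, +oo) are used. *)
Definition operator_convex (f : R -> R) : Prop :=
  forall n (A B : 'M[R[i]]_n) (t : R),
    posdefmx A -> posdefmx B -> 0 <= t <= 1 ->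
    loewner_le (mxfun f (t%:C *: A + (1 - t)%:C *: B))
               (t%:C *: mxfun f A + (1 - t)%:C *: mxfun f B).

Definition eigenvalues_down n (A : 'M[R[i]]_n) : seq R :=
  sort (fun x y => y <= x)
    [seq complex.Re (spectral_diag A 0 i) | i <- enum 'I_n].

Definition lambda_down n (A : 'M[R[i]]_n) : 'M[R[i]]_n :=
  diag_mx (\row_(i < n) (nth 0 (eigenvalues_down A) i)%:C).

Definition retr n (A : 'M[R[i]]_n) : R := complex.Re (\tr A).

Definition mxinvsqrt n (A : 'M[R[i]]_n) : 'M[R[i]]_n :=
  mxfun (fun x => (Num.sqrt x)^-1) A.

Definition maxfdiv_pd n (f : R -> R) (rho sigma : 'M[R[i]]_n) : R :=
  retr (sigma *m mxfun f (mxinvsqrt sigma *m rho *m mxinvsqrt sigma)).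

Definition maxfdiv n (f : R -> R) (rho sigma : 'M[R[i]]_n) : \bar R :=
  lim ((maxfdiv_pd f (rho + (eps%:C)%:M) (sigma + (eps%:C)%:M))%:E
         @[eps --> 0^'+]).

(* [via_inv B F] is the value at [B^-1] of the expression [F]; for singular
   positive semidefinite [B] it is the limit of the values at
   [(B + eps I)^-1]. When [B] is positive definite the limit is [F (B^-1)]
   for continuous [F]. *)
Definition via_inv n (B : 'M[R[i]]_n) (F : 'M[R[i]]_n -> \bar R) : \bar R :=
  lim (F (invmx (B + (eps%:C)%:M)) @[eps --> 0^'+]).

(* Tr (A / B) *)
Definition trquo n (A B : 'M[R[i]]_n) : \bar R :=
  via_inv B (fun Binv => (retr (A *m Binv))%:E).

Definition integral_repr (f : R -> R) (c : R)
    (lam : {measure set (measurableTypeR R) -> \bar R}) : Prop :=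
  [/\ 0 <= c,
      (\int[lam]_(s in `[0%R, +oo[) ((1 + s)^-1)%:E < +oo)%E &
      forall x : R, 0 < x ->
        (f x)%:E =
        ((f 1 + derive1 f 1 * (x - 1) + c * (x - 1) ^+ 2)%:E +
         \int[lam]_(s in `[0%R, +oo[) ((x - 1) ^+ 2 / (x + s))%:E)%E].

(* The quantity denoted S_f(Rd || D) for diagonal positive semidefinite [Rd] and
   [D], in terms of the pair [(c, lam)] representing [f]. The matrix [D^-1] may
   occur both in the numerator and in the denominator of a quotient; it is the
   same regularized inverse in both. In [\bar R], [0 * +oo = 0], so the second
   term vanishes when [c = 0]. *)
Definition repr_maxfdiv n (f : R -> R) (c : R)
    (lam : {measure set (measurableTypeR R) -> \bar R})
    (Rd D : 'M[R[i]]_n) : \bar R :=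
  ((f 1)%:E
   + c%:E * (trquo (Rd *m Rd) D - 1)
   + \int[lam]_(s in `[0%R, +oo[)
       via_inv D (fun Di => trquo (Di *m (Rd *m Rd)) (Di *m Rd + (s%:C)%:M))
   - 2%:E * \int[lam]_(s in `[0%R, +oo[)
       via_inv D (fun Di => trquo Rd (Di *m Rd + (s%:C)%:M))
   + \int[lam]_(s in `[0%R, +oo[)
       via_inv D (fun Di => trquo D (Di *m Rd + (s%:C)%:M)))%E.

End Matrices.

Definition is_min {d} {T : porderType d} (E : set T) (m : T) : Prop :=
  E m /\ lbound E m.

Definition argmin {d} {T : porderType d} {I : Type} (A : set I) (F : I -> T)
    : set I :=
  [set u | A u /\ lbound (F @` A) (F u)].

(* Main.v *)
Require Import Defs.
From HB Require Import structures.
From mathcomp Require Import all_boot all_order all_algebra all_fingroup.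
From mathcomp Require Import complex.
From mathcomp Require Import all_classical all_reals all_analysis.
From mathcomp Require Import measurable_realfun.
From mathcomp Require Import ring lra.

Set Implicit Arguments.
Unset Strict Implicit.
Unset Printing Implicit Defensive.

Import Order.TTheory GRing.Theory Num.Theory.
Import numFieldNormedType.Exports.

Local Open Scope classical_set_scope.
Local Open Scope ring_scope.
Local Open Scope complex_scope.
Local Open Scope sesquilinear_scope.

(** The integral representation writes [f] as an affine function plus
    a nonnegative combination of [(x - 1)^2] and of the functions
    [(x - 1)^2 / (x + s)]. If [rho] and [sigma] are positive definite, a single
    congruence diagonalizes both, [rho = T^* diag(x) T] and [sigma = T^* T], and
    in these coordinates [sigma f(sigma^(-1/2) rho sigma^(-1/2))] has trace
    [sum_i f(x_i) |T_i|^2], with [T_i] the rows of [T]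
    ([maxfdiv_pd_congdiag]). Hence the divergence is

      [f(1) Tr sigma + f'(1) Tr (rho - sigma) + c Tr K sigma^-1 K
       + int Tr K (rho + s sigma)^-1 K dlam(s)],   [K = rho - sigma],

    ([maxfdiv_pd_integral]), and the operator-theoretic content is reduced to
    the two quadratic divergences [chi2div] and [mixdiv s].

    Regularizing by [e I] leaves [K] alone and adds multiples of [I] to the
    matrices that are inverted, so the quadratic terms decrease in [e]
    ([mixdiv_shift_antitone]); thus the defining limit exists for every pair of
    states, and an inequality between regularized divergences passes to it.

    It remains to bound the quadratic divergences below by their values at the
    commuting pair with eigenvalues [r] and [d] in the same order. Both bounds
    come from the rearrangement inequality
    [Tr (A B) >= sum_i a_i b_i] for oppositely ordered eigenvalues
    ([trace_rearrangement]). For [chi2div], and for [mixdiv 0], it applies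
    directly after expanding the square. For [s > 0],

      [mixdiv s = Tr rho + Tr sigma / s
        - ((1 + s)^2 / s) Tr (sigma^-1 + s rho^-1)^-1],

    and the trace of the inverse of a sum [A + B] is largest for
    equally ordered eigenvalues ([retr_inv_sum_le]): with
    [Z = (A + B)^-1], sum the inequalities
    [1 / (a_i + b_i) >= 2 z_i - z_i^2 (a_i + b_i)], that is, tangent lines to
    the convex function [1 / t], and use rearrangement for
    [Tr (Z^2 A)] and [Tr (Z^2 B)].

    At the aligned pair everything is diagonal: by monotone convergence the
    limit is a sum of scalar quotients in the extended reals
    ([maxfdiv_udiag]), and expanding [(r - d)^2] turns it into the stated
    combination of integrals ([repr_maxfdivE]). *)

(** * Matrices with real diagonal form *)

Definition rdiag (R : realType) (n : nat) (a : 'I_n -> R) : 'M[R[i]]_n :=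
  diag_mx (\row_i (a i)%:C).

(** Unitary [T] gives the Hermitian matrices with eigenvalues [a]; invertible
    [T] is needed to diagonalize two matrices at once. *)
HB.lock Definition congdiag (R : realType) (n : nat) (T : 'M[R[i]]_n)
  (a : 'I_n -> R) : 'M[R[i]]_n := T^t* *m rdiag a *m T.

Section DiagonalForms.
Variables (R : realType) (n : nat).
Local Notation C := R[i].
Implicit Types (T Q A : 'M[C]_n) (a b d : 'I_n -> R).

Lemma mulmx_tC m p q (A : 'M[C]_(m, p)) (B : 'M[C]_(p, q)) :
  (A *m B)^t* = B^t* *m A^t*.
Proof. by rewrite trmx_mul map_mxM. Qed.

Lemma rdiagD a b : rdiag a + rdiag b = rdiag (fun i => a i + b i).
Proof.
by apply/matrixP => i j; rewrite !mxE -mulrnDl -rmorphD.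
Qed.

Lemma rdiagB a b : rdiag a - rdiag b = rdiag (fun i => a i - b i).
Proof.
by apply/matrixP => i j; rewrite !mxE -mulrnBl -rmorphB.
Qed.

Lemma rdiagZ (k : R) a : k%:C *: rdiag a = rdiag (fun i => k * a i).
Proof. by apply/matrixP => i j; rewrite !mxE mulrnAr -rmorphM. Qed.

Lemma rdiagM a b : rdiag a *m rdiag b = rdiag (fun i => a i * b i).
Proof.
by rewrite mulmx_diag; congr diag_mx; apply/rowP => i; rewrite !mxE -rmorphM.
Qed.

Lemma rdiag_const (k : R) : rdiag (fun _ : 'I_n => k) = (k%:C)%:M.
Proof. by apply/matrixP => i j; rewrite !mxE. Qed.

Lemma rdiag1 : rdiag (fun _ : 'I_n => 1 : R) = 1%:M.
Proof. by rewrite rdiag_const. Qed.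

Lemma eq_rdiag a b : a =1 b -> rdiag a = rdiag b.
Proof. by move=> ab; congr diag_mx; apply/rowP => i; rewrite !mxE ab. Qed.

Lemma conjC_real (x : R) : Num.conj (x%:C : C) = x%:C.
Proof. by apply/CrealP; rewrite complex_real. Qed.

Lemma rdiag_tC a : (rdiag a)^t* = rdiag a.
Proof.
apply/matrixP => i j; rewrite !mxE eq_sym.
have [->|_] := eqVneq i j; first by rewrite !mulr1n; exact: conjC_real.
by rewrite !mulr0n rmorph0.
Qed.

Lemma rdiag_unit a : (forall i, a i != 0) -> rdiag a \in unitmx.
Proof.
move=> a0; rewrite unitmxE det_diag unitfE; apply/prodf_neq0 => i _.
by rewrite mxE; apply: contra_neq (a0 i) => /complexI.
Qed.

Lemma retrD A A' : retr (A + A') = retr A + retr A'.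
Proof. by rewrite /retr raddfD /= raddfD. Qed.

Lemma retrB A A' : retr (A - A') = retr A - retr A'.
Proof. by rewrite /retr raddfB /= raddfB. Qed.

Lemma retr_rdiag a : retr (rdiag a) = \sum_i a i.
Proof.
rewrite /retr /mxtrace raddf_sum /=; apply: eq_bigr => i _.
by rewrite !mxE eqxx mulr1n.
Qed.

Definition normsq (z : C) : R := complex.Re z ^+ 2 + complex.Im z ^+ 2.

Lemma normsq_ge0 z : 0 <= normsq z.
Proof. by rewrite addr_ge0 ?sqr_ge0. Qed.

Lemma normsqE z : (normsq z)%:C = z * Num.conj z.
Proof. by rewrite -normCK -add_Re2_Im2. Qed.

(** These are the diagonal entries of [T T^t*]: the weights that the trace puts
    on the coefficients of [congdiag T a]. *)
Definition rownormsq T i : R := \sum_j normsq (T i j).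

Lemma rownormsq_ge0 T i : 0 <= rownormsq T i.
Proof. by apply: sumr_ge0 => j _; exact: normsq_ge0. Qed.

Lemma rownormsqE T i : (rownormsq T i)%:C = (T *m T^t*) i i.
Proof.
rewrite mxE rmorph_sum; apply: eq_bigr => j _.
by rewrite !mxE; exact: normsqE.
Qed.

Lemma congdiagE T a : congdiag T a = T^t* *m rdiag a *m T.
Proof. by rewrite congdiag.unlock. Qed.

Lemma congdiagD T a b : congdiag T a + congdiag T b = congdiag T (fun i => a i + b i).
Proof. by rewrite !congdiagE -rdiagD mulmxDr mulmxDl. Qed.

Lemma congdiagB T a b : congdiag T a - congdiag T b = congdiag T (fun i => a i - b i).
Proof. by rewrite !congdiagE -rdiagB mulmxBr mulmxBl. Qed.

Lemma congdiagZ (k : R) T a : k%:C *: congdiag T a = congdiag T (fun i => k * a i).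
Proof. by rewrite !congdiagE -rdiagZ -scalemxAr -scalemxAl. Qed.

Lemma eq_congdiag T a b : a =1 b -> congdiag T a = congdiag T b.
Proof. by move=> ab; rewrite !congdiagE (eq_rdiag ab). Qed.

Lemma congdiag_tC T a : (congdiag T a)^t* = congdiag T a.
Proof. by rewrite !congdiagE !mulmx_tC trmxCK rdiag_tC mulmxA. Qed.

Lemma congdiag_congr T A a : A^t* *m congdiag T a *m A = congdiag (T *m A) a.
Proof. by rewrite !congdiagE mulmx_tC !mulmxA. Qed.

Lemma retr_congdiag T a : retr (congdiag T a) = \sum_i a i * rownormsq T i.
Proof.
rewrite /retr !congdiagE mxtrace_mulC mulmxA /mxtrace raddf_sum /=.
apply: eq_bigr => i _.
rewrite /rdiag mul_mx_diag [X in complex.Re X]mxE -rownormsqE.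
by rewrite [(\row__ _) _ _]mxE -rmorphM mulrC.
Qed.

Lemma tC_unit T : T \in unitmx -> T^t* \in unitmx.
Proof. by rewrite map_unitmx unitmx_tr. Qed.

Lemma invmxM A A' : A \in unitmx -> A' \in unitmx ->
  invmx (A *m A') = invmx A' *m invmx A.
Proof.
move=> uA uA'; have uAA' : A *m A' \in unitmx by rewrite unitmx_mul uA.
by rewrite -[RHS](mulmxK uAA') mulmxA -(mulmxA _ (invmx A)) mulVmx// mulmx1
  mulVmx// mul1mx.
Qed.

Lemma invmx_tC T : invmx (T^t*) = (invmx T)^t*.
Proof. by rewrite trmx_inv map_invmx. Qed.

Lemma rdiagV a : (forall i, a i != 0) -> invmx (rdiag a) = rdiag (fun i => (a i)^-1).
Proof.
move=> a0; rewrite -[RHS](mulKmx (rdiag_unit a0)) rdiagM.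
by rewrite (@eq_rdiag (fun i => _ / _) (fun=> 1)) ?rdiag1 ?mulmx1// => i; rewrite divff.
Qed.

Lemma congdiag_unit T a : T \in unitmx -> (forall i, a i != 0) ->
  congdiag T a \in unitmx.
Proof. by move=> uT a0; rewrite congdiagE !unitmx_mul uT tC_unit// rdiag_unit. Qed.

(** Inversion passes to the dual congruence, so sums of inverses of matrices
    that are diagonal for a common [T] are again diagonal for a common one. *)
Lemma congdiagV T a : T \in unitmx -> (forall i, a i != 0) ->
  invmx (congdiag T a) = congdiag ((invmx T)^t*) (fun i => (a i)^-1).
Proof.
move=> uT a0; rewrite !congdiagE trmxCK !invmxM ?unitmx_mul ?tC_unit ?rdiag_unit//.
by rewrite rdiagV// invmx_tC mulmxA.
Qed.

Lemma mulmx_conjugate_cancel (X Y X' Y' D E : 'M[C]_n) :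
    Y *m Y' = 1%:M -> X' *m X = 1%:M ->
  (X *m D *m Y) *m (Y' *m E *m X') *m (X *m D *m Y) = X *m (D *m E *m D) *m Y.
Proof.
move=> YY XX; transitivity (X *m D *m (Y *m Y') *m E *m (X' *m X) *m D *m Y).
  by rewrite !mulmxA.
by rewrite YY XX !mulmx1 !mulmxA.
Qed.

(** A quotient of matrices diagonal for the same congruence is computed on the
    coefficients: the two copies of [T] next to the inverse cancel. *)
Lemma congdiag_quo T a b : T \in unitmx -> (forall i, b i != 0) ->
  congdiag T a *m invmx (congdiag T b) *m congdiag T a =
  congdiag T (fun i => a i ^+ 2 / b i).
Proof.
move=> uT b0; rewrite congdiagV// !congdiagE trmxCK -invmx_tC.
rewrite (mulmx_conjugate_cancel _ _ (mulmxV uT) (mulVmx (tC_unit uT))).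
rewrite rdiagM rdiagM -!congdiagE.
by apply: eq_congdiag => i; rewrite expr2 mulrAC.
Qed.

Lemma unitarymx_tCmul Q : Q \is unitarymx -> Q^t* *m Q = 1%:M.
Proof. by move=> /unitarymxP/mulmx1C. Qed.

Lemma rownormsq_unitary Q i : Q \is unitarymx -> rownormsq Q i = 1.
Proof. by move=> /unitarymxP QQ; apply: complexI; rewrite rownormsqE QQ mxE eqxx. Qed.

(** From here on the prefix [udiag] refers to [congdiag] with a unitary matrix,
    for which products and inverses are taken on the coefficients. *)
Lemma retr_udiag Q a : Q \is unitarymx -> retr (congdiag Q a) = \sum_i a i.
Proof.
move=> uQ; rewrite retr_congdiag; apply: eq_bigr => i _.
by rewrite rownormsq_unitary// mulr1.
Qed.

Lemma udiagM Q a b : Q \is unitarymx ->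
  congdiag Q a *m congdiag Q b = congdiag Q (fun i => a i * b i).
Proof.
move=> /unitarymxP QQ; rewrite (congdiagE Q a) (congdiagE Q b) !mulmxA.
by rewrite -(mulmxA _ Q) QQ mulmx1 -(mulmxA (Q^t*)) rdiagM -congdiagE.
Qed.

Lemma udiag_scalar Q (k : R) : Q \is unitarymx -> congdiag Q (fun=> k) = (k%:C)%:M.
Proof.
move=> uQ; rewrite !congdiagE rdiag_const mul_mx_scalar -scalemxAl.
by rewrite unitarymx_tCmul// scalemx1.
Qed.

Lemma udiagV Q a : Q \is unitarymx -> (forall i, a i != 0) ->
  invmx (congdiag Q a) = congdiag Q (fun i => (a i)^-1).
Proof.
move=> uQ a0; rewrite congdiagV ?unitarymx_unit//.
by rewrite invmx_unitary// trmxCK.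
Qed.

End DiagonalForms.

(** * Spectral decomposition and positivity *)

Section SpectralForms.
Variables (R : realType) (n : nat).
Local Notation C := R[i].
Implicit Types (T Q A rho sigma : 'M[C]_n) (a b d : 'I_n -> R).

Lemma hermsymmx_tC A : (A \is hermsymmx) = (A == A^t*).
Proof. by rewrite is_hermitianmxE expr0 scale1r. Qed.

Lemma congdiag_herm T a : congdiag T a \is hermsymmx.
Proof. by rewrite hermsymmx_tC congdiag_tC. Qed.

(** The same [Q] and [a] serve for all [f], which is what allows [mxfun] to be
    evaluated without further reference to [spectralmx]. *)
Lemma mxfun_spectral A : A \is hermsymmx ->
  exists Q a, [/\ Q \is unitarymx, A = congdiag Q a &
    forall f, mxfun f A = congdiag Q (fun i => f (a i))].
Proof.
move=> hA; have /hermitian_normalmx/orthomx_spectralP := hA.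
have := hermitian_spectral_diag_real hA; have := spectral_unitarymx A.
rewrite /mxfun; move: (spectralmx A) (spectral_diag A) => Q D uQ /mxOverP realD.
rewrite (invmx_unitary uQ) => AE.
exists Q, (fun i => complex.Re (D 0 i)).
split=> [||f]; [exact: uQ| |]; rewrite !congdiagE /rdiag.
  suff {1}<- : D = \row_i (complex.Re (D 0 i))%:C by [].
  by apply/rowP => i; rewrite mxE RRe_real.
suff -> : map_mx (fun z : C => (f (complex.Re z))%:C) D =
  \row_i (f (complex.Re (D 0 i)))%:C by [].
by apply/rowP => i; rewrite !mxE.
Qed.

Lemma congdiag_entry T a i j :
  congdiag T a i j = \sum_k Num.conj (T k i) * (a k)%:C * T k j.
Proof.
by rewrite !congdiagE /rdiag mul_mx_diag mxE; apply: eq_bigr => k _; rewrite !mxE.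
Qed.

Lemma congdiag_row_perm (s : 'S_n) T a :
  congdiag (row_perm s T) (fun i => a (s i)) = congdiag T a.
Proof.
apply/matrixP => i j; rewrite !congdiag_entry [RHS](reindex_perm s).
by apply: eq_bigr => k _; rewrite !mxE.
Qed.

Lemma row_perm_unitary (s : 'S_n) Q : Q \is unitarymx -> row_perm s Q \is unitarymx.
Proof.
move=> /unitarymxP QQ; apply/unitarymxP/matrixP => i j.
have /matrixP/(_ (s i) (s j)) := QQ; rewrite !mxE (inj_eq perm_inj) => <-.
by apply: eq_bigr => k _; rewrite !mxE.
Qed.

Lemma sorting_perm a :
  exists s : 'S_n, {homo (fun i => a (s i)) : i j / (i <= j)%N >-> i <= j}.
Proof.
pose t := [tuple a i | i < n].
have : perm_eq (sort <=%R t) t by rewrite perm_sort.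
have szt : size (sort <=%R t) == n by rewrite size_sort size_tuple.
move=> /(@tuple_permP _ _ (Tuple szt)) [s /= st]; exists s => i j ij.
have nthE (k : 'I_n) : nth 0 (sort <=%R t) k = a (s k).
  by rewrite st (nth_map k) ?size_enum_ord// nth_ord_enum tnth_mktuple.
rewrite -!nthE; apply: (sorted_leq_nth le_trans le_refl) => //.
- exact/sort_sorted/le_total.
- by rewrite inE (eqP szt).
- by rewrite inE (eqP szt).
Qed.

(** Rearrangement compares eigenvalues by rank, whereas the spectral theorem
    lists them in no particular order. *)
Lemma sorted_spectral A : A \is hermsymmx ->
  exists Q a, [/\ Q \is unitarymx, A = congdiag Q a
    & {homo a : i j / (i <= j)%N >-> i <= j}].
Proof.
move=> /mxfun_spectral[Q [a [uQ AE _]]]; have [s sP] := sorting_perm a.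
exists (row_perm s Q), (fun i => a (s i)).
by rewrite row_perm_unitary// congdiag_row_perm.
Qed.

Lemma diagonal_form m (v : 'M[C]_(m, n)) a i :
  (v *m rdiag a *m v^t*) i i = (\sum_k a k * normsq (v i k))%:C.
Proof.
rewrite /rdiag mul_mx_diag mxE rmorph_sum; apply: eq_bigr => k _.
by rewrite !mxE mulrAC -normsqE mulrC -rmorphM.
Qed.

Lemma normsq_gt0 (z : C) : z != 0 -> 0 < normsq z.
Proof.
case: z => x y; rewrite eq_complex /= negb_and => xy.
rewrite /normsq lt_def addr_ge0 ?sqr_ge0//= andbT paddr_eq0 ?sqr_ge0//.
by rewrite !sqrf_eq0 negb_and.
Qed.

Lemma congdiag_quadratic T a (u : 'rV[C]_n) :
  (u *m congdiag T a *m u^t*) 0 0 =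
  (\sum_k a k * normsq ((u *m T^t*) 0 k))%:C.
Proof.
by rewrite -diagonal_form mulmx_tC trmxCK !congdiagE !mulmxA.
Qed.

Lemma psdmx_congdiag T a : (forall i, 0 <= a i) -> psdmx (congdiag T a).
Proof.
move=> a0; split=> [|u]; first exact: congdiag_herm.
rewrite congdiag_quadratic lecR; apply: sumr_ge0 => k _.
by rewrite mulr_ge0 ?normsq_ge0.
Qed.

Lemma posdefmx_congdiag T a : T \in unitmx -> (forall i, 0 < a i) ->
  posdefmx (congdiag T a).
Proof.
move=> uT a0; split; first exact: congdiag_herm.
move=> u u0; have v0 : u *m T^t* != 0.
  by apply: contra_neq u0 => uT0; rewrite -(mulmxK (tC_unit uT) u) uT0 mul0mx.
have term_ge0 k : 0 <= a k * normsq ((u *m T^t*) 0 k).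
  by rewrite mulr_ge0 ?normsq_ge0// ltW.
rewrite congdiag_quadratic ltcR lt_def sumr_ge0 ?andbT//.
apply: contra v0; rewrite psumr_eq0// => /allP vv.
apply/eqP/rowP => k; rewrite [RHS]mxE; apply/eqP.
apply: contraT => /normsq_gt0; rewrite ltNge => /negP[].
have := vv k (mem_index_enum k); rewrite mulf_eq0 gt_eqF//= => /eqP ->.
exact: lexx.
Qed.

(** The rows of the inverse of [T^t*] are dual to those of [T], so the quadratic form
    evaluated on them reads off the coefficients [a i]; positivity of the form
    therefore passes to the coefficients. *)
Lemma congdiag_dual_row T a i : T \in unitmx ->
  let u := row i (invmx (T^t*)) in (u *m congdiag T a *m u^t*) 0 0 = (a i)%:C.
Proof.
move=> uT u; have uTE : u *m T^t* = delta_mx 0 i.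
  by rewrite -row_mul mulVmx ?tC_unit// row1.
rewrite congdiag_quadratic uTE.
rewrite (bigD1 i)//= big1 ?addr0 => [|k ki]; rewrite mxE eqxx/=.
  by rewrite eqxx /normsq/= expr1n expr0n/= addr0 mulr1.
by rewrite (negbTE ki) /normsq/= expr0n/= addr0 mulr0.
Qed.

Lemma posdefmx_gt0 T a : T \in unitmx -> posdefmx (congdiag T a) ->
  forall i, 0 < a i.
Proof.
move=> uT [_ pos] i; rewrite -ltcR -(congdiag_dual_row a i uT); apply: pos.
apply: contraTneq isT => u0; have := row1 C i.
rewrite -(mulVmx (tC_unit uT)) row_mul u0 mul0mx => /rowP/(_ i)/eqP.
by rewrite !mxE !eqxx eq_sym oner_eq0.
Qed.

Lemma psdmx_ge0 T a : T \in unitmx -> psdmx (congdiag T a) -> forall i, 0 <= a i.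
Proof. by move=> uT [_ pos] i; rewrite -lecR -(congdiag_dual_row a i uT). Qed.

End SpectralForms.

(** * Traces of products of Hermitian matrices *)

Section TraceRearrangement.
Variables (R : realType) (n : nat).
Local Notation C := R[i].
Implicit Types (Q P : 'M[C]_n) (a b : 'I_n -> R).

(** The weights are the squared moduli of the entries of a unitary matrix,
    hence doubly stochastic. *)
Lemma retr_udiagM Q P a b : Q \is unitarymx -> P \is unitarymx ->
  retr (congdiag Q a *m congdiag P b) =
  \sum_i \sum_j a i * b j * normsq ((Q *m P^t*) i j).
Proof.
move=> uQ uP; rewrite /retr; have -> : \tr (congdiag Q a *m congdiag P b) =
    \tr ((Q *m P^t*) *m rdiag b *m (Q *m P^t*)^t* *m rdiag a).
  rewrite mulmx_tC trmxCK [LHS]mxtrace_mulC !congdiagE mulmxA mxtrace_mulC.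
  by rewrite !mulmxA.
rewrite /mxtrace raddf_sum /=; apply: eq_bigr => i _.
rewrite {2}/rdiag mul_mx_diag [X in complex.Re X]mxE diagonal_form.
rewrite [(\row__ _) _ _]mxE -rmorphM /= mulr_suml; apply: eq_bigr => j _.
by rewrite mulrC mulrA.
Qed.

(** A dual certificate for the transportation problem of minimizing
    [sum_ij a_i b_j W_ij] over doubly stochastic [W]: rewritten as
    [u i + (a j * b j - u j) <= a i * b j], with equality for [i = j], it shows
    that the identity is optimal. The potential is the discrete integral
    [u_i = sum_(l < i) (a_(l+1) - a_l) b_l]. *)
Lemma rearrangement_potential a b :
    {homo a : i j / (i <= j)%N >-> i <= j} ->
    {homo b : i j / (i <= j)%N >-> j <= i} ->
  exists u : 'I_n -> R, forall i j, u i - u j <= (a i - a j) * b j.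
Proof.
case: n a b => [|m] a b homa homb; first by exists (fun=> 0) => -[].
(* clamping extends the finite sequences to monotone sequences over nat *)
pose cl k : 'I_m.+1 := inord (minn k m).
have clE k : cl k = minn k m :> nat by rewrite inordK// ltnS geq_minr.
have cl_homo k l : (k <= l)%N -> (cl k <= cl l)%N.
  by move=> kl; rewrite !clE leq_min geq_minr andbT (leq_trans (geq_minl _ _)).
pose v k := \sum_(0 <= l < k) (a (cl l.+1) - a (cl l)) * b (cl l).
have vS k : v k.+1 = v k + (a (cl k.+1) - a (cl k)) * b (cl k).
  by rewrite /v big_nat_recr.
have aS k l : (k <= l)%N -> a (cl k) <= a (cl l) by move=> kl; exact/homa/cl_homo.
have bS k l : (k <= l)%N -> b (cl l) <= b (cl k) by move=> kl; exact/homb/cl_homo.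
have up k l : v (k + l)%N - v k <= (a (cl (k + l)%N) - a (cl k)) * b (cl k).
  elim: l => [|l IH]; first by rewrite addn0 !subrr mul0r.
  rewrite addnS vS; have := bS k (k + l)%N (leq_addr _ _).
  by have := aS _ _ (leqnSn (k + l)); nra.
have low k l : (a (cl (k + l)%N) - a (cl k)) * b (cl (k + l)%N) <= v (k + l)%N - v k.
  elim: l => [|l IH]; first by rewrite addn0 !subrr mul0r.
  rewrite addnS vS; have := bS _ _ (leqnSn (k + l)).
  have := aS k (k + l)%N (leq_addr _ _).
  by have := aS _ _ (leqnSn (k + l)); nra.
have clK (i : 'I_m.+1) : cl i = i.
  by apply: ord_inj; rewrite clE; apply/minn_idPl; rewrite -ltnS.
exists (fun i => v i) => i j; case: (leqP i j) => [ij|/ltnW ji].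
  by have := low i (j - i)%N; rewrite subnKC// !clK; nra.
by have := up j (i - j)%N; rewrite subnKC// !clK.
Qed.

Lemma doubly_stochastic_rearrangement (W : 'I_n -> 'I_n -> R) a b :
    (forall i j, 0 <= W i j) ->
    (forall i, \sum_j W i j = 1) -> (forall j, \sum_i W i j = 1) ->
    {homo a : i j / (i <= j)%N >-> i <= j} ->
    {homo b : i j / (i <= j)%N >-> j <= i} ->
  \sum_i a i * b i <= \sum_i \sum_j a i * b j * W i j.
Proof.
move=> W0 rowW colW homa homb; have [u uP] := rearrangement_potential homa homb.
have -> : \sum_i a i * b i =
    \sum_i \sum_j (u i + (a j * b j - u j)) * W i j.
  under [RHS]eq_bigr do (under eq_bigr do rewrite mulrDl; rewrite big_split).
  rewrite big_split /= [X in _ = _ + X]exchange_big /=.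
  under [X in _ = X + _]eq_bigr do rewrite -mulr_sumr rowW mulr1.
  under [X in _ = _ + X]eq_bigr do rewrite -mulr_sumr colW mulr1.
  by rewrite -big_split; apply: eq_bigr => i _ /=; rewrite addrC subrK.
apply: ler_sum => i _; apply: ler_sum => j _; rewrite ler_wpM2r//.
by have := uP i j; lra.
Qed.

Lemma normsq_conj z : normsq (Num.conj z : C) = normsq z.
Proof. by apply: complexI; rewrite !normsqE conjCK mulrC. Qed.

(** One half of von Neumann's trace inequality: among Hermitian matrices with
    given eigenvalues the trace of the product is least for a common
    eigenbasis with opposite orders. *)
Lemma trace_rearrangement Q P a b : Q \is unitarymx -> P \is unitarymx ->
    {homo a : i j / (i <= j)%N >-> i <= j} ->
    {homo b : i j / (i <= j)%N >-> j <= i} ->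
  \sum_i a i * b i <= retr (congdiag Q a *m congdiag P b).
Proof.
move=> uQ uP homa homb; rewrite retr_udiagM//.
have uPt : P^t* \is unitarymx by rewrite trmxC_unitary.
have uU : Q *m P^t* \is unitarymx := mul_unitarymx uQ uPt.
apply: doubly_stochastic_rearrangement => //.
- by move=> i j; exact: normsq_ge0.
- by move=> i; exact: rownormsq_unitary.
move=> j; have := @rownormsq_unitary _ _ ((Q *m P^t*)^t*) j.
rewrite trmxC_unitary => /(_ uU) <-; apply: eq_bigr => i _.
by rewrite [in RHS]mxE [in RHS]mxE normsq_conj.
Qed.

Lemma trace_rearrangement_desc Q P a b : Q \is unitarymx -> P \is unitarymx ->
    {homo a : i j / (i <= j)%N >-> j <= i} ->
    {homo b : i j / (i <= j)%N >-> i <= j} ->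
  \sum_i a i * b i <= retr (congdiag Q a *m congdiag P b).
Proof.
move=> uQ uP homa homb; rewrite /retr mxtrace_mulC.
under eq_bigr do rewrite mulrC.
exact: (trace_rearrangement uP uQ homb homa).
Qed.

End TraceRearrangement.

(** * Two quadratic divergences *)

Section Divergence.
Variables (R : realType) (n : nat).
Local Notation C := R[i].
Implicit Types (T Q A rho sigma : 'M[C]_n) (a b d : 'I_n -> R).

(** With [K = sigma^(-1/2)] and [K rho K = Q^* diag(x) Q], the congruence
    [T = Q sigma^(1/2)] carries the identity to [sigma] and [diag(x)] to [rho];
    cyclicity of the trace then moves one factor [sigma^(1/2)] to the right
    end of [sigma f(K rho K)]. *)
Lemma maxfdiv_pd_congdiag rho sigma : posdefmx rho -> posdefmx sigma ->
  exists T x, [/\ T \in unitmx, forall i, 0 < x i, rho = congdiag T x,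
    sigma = congdiag T (fun=> 1) &
    forall f, maxfdiv_pd f rho sigma = \sum_i f (x i) * rownormsq T i].
Proof.
move=> prho psigma; have [hrho _] := prho; have [hsigma _] := psigma.
have [P [d [uP sigmaE sigmaF]]] := mxfun_spectral hsigma.
rewrite /maxfdiv_pd /mxinvsqrt sigmaF {sigmaF}.
rewrite sigmaE in psigma *.
have d0 := posdefmx_gt0 (unitarymx_unit uP) psigma.
have sq0 i : Num.sqrt (d i) != 0 by rewrite gt_eqF// sqrtr_gt0.
set K := congdiag P (fun i => (Num.sqrt (d i))^-1).
pose L := congdiag P (fun i => Num.sqrt (d i)).
have KL : K *m L = 1%:M.
  rewrite (udiagM _ _ uP) (@eq_congdiag _ _ _ _ (fun=> 1)) => [|i].
    exact: udiag_scalar.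
  by rewrite mulVf.
have LL : congdiag P d = L *m L.
  rewrite (udiagM _ _ uP); apply: eq_congdiag => i; rewrite -expr2 sqr_sqrtr//.
  exact: ltW.
have Lt : L^t* = L by exact: congdiag_tC.
have Kt : K^t* = K by exact: congdiag_tC.
rewrite {}LL; clear sigmaE sq0 d0 psigma hsigma.
move: K L KL Lt Kt => K L KL Lt Kt; have LK := mulmx1C KL.
have hX : K *m rho *m K \is hermsymmx.
  move: hrho; rewrite !hermsymmx_tC => /eqP hrho.
  by rewrite !mulmx_tC Kt -hrho mulmxA.
have [Q [x [uQ XE XF]]] := mxfun_spectral hX.
have rhoE : rho = congdiag (Q *m L) x.
  rewrite -congdiag_congr -XE Lt -!mulmxA KL mulmx1 mulmxA LK.
  by rewrite mul1mx.
have uT : Q *m L \in unitmx.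
  by rewrite unitmx_mul (unitarymx_unit uQ) (mulmx1_unit LK).1.
exists (Q *m L), x; split; [exact: uT| |exact: rhoE| |].
- by apply: (posdefmx_gt0 uT); rewrite -rhoE.
- by rewrite -congdiag_congr Lt udiag_scalar// mulmx1.
move=> f; rewrite -retr_congdiag -congdiag_congr XF Lt.
by rewrite /retr -[L *m L *m _]mulmxA [in LHS]mxtrace_mulC.
Qed.

(** The divergence attached to [f(x) = (x - 1)^2 / (x + s)]; [chi2div] belongs
    to [f(x) = (x - 1)^2], the rescaled limit of large [s]. *)
Definition mixdiv (s : R) rho sigma : R :=
  retr ((rho - sigma) *m invmx (rho + s%:C *: sigma) *m (rho - sigma)).

Definition chi2div rho sigma : R :=
  retr ((rho - sigma) *m invmx sigma *m (rho - sigma)).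

Lemma mixdiv_congdiag s T a b : T \in unitmx -> (forall i, a i + s * b i != 0) ->
  mixdiv s (congdiag T a) (congdiag T b) =
  \sum_i (a i - b i) ^+ 2 / (a i + s * b i) * rownormsq T i.
Proof.
move=> uT ab0; rewrite /mixdiv congdiagB congdiagZ congdiagD.
by rewrite congdiag_quo// retr_congdiag.
Qed.

Lemma chi2div_congdiag T a b : T \in unitmx -> (forall i, b i != 0) ->
  chi2div (congdiag T a) (congdiag T b) =
  \sum_i (a i - b i) ^+ 2 / b i * rownormsq T i.
Proof. by move=> uT b0; rewrite /chi2div congdiagB congdiag_quo// retr_congdiag. Qed.

(** In an eigenbasis of [M] the trace is a combination of [1 / (m_i + e)] with
    nonnegative weights. *)
Lemma regularized_inverse_antitone A M (e e' : R) : psdmx M -> 0 < e -> e <= e' ->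
  retr (A^t* *m invmx (M + (e'%:C)%:M) *m A) <=
  retr (A^t* *m invmx (M + (e%:C)%:M) *m A).
Proof.
move=> psdM e0 ee'; have [Q [m [uQ ME _]]] := sorted_spectral (proj1 psdM).
rewrite ME in psdM *; have m0 := psdmx_ge0 (unitarymx_unit uQ) psdM.
have val (k : R) : 0 < k -> retr (A^t* *m invmx (congdiag Q m + (k%:C)%:M) *m A) =
    \sum_i (m i + k)^-1 * rownormsq (Q *m A) i.
  move=> k0; rewrite -(udiag_scalar _ uQ) congdiagD (udiagV uQ) => [|i].
    by rewrite congdiag_congr retr_congdiag.
  by rewrite gt_eqF// ltr_wpDl.
rewrite !val ?(lt_le_trans e0)//; apply: ler_sum => i _.
rewrite ler_wpM2r ?rownormsq_ge0// lef_pV2 ?posrE ?lerD2l//.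
  by rewrite ltr_wpDl// (lt_le_trans e0).
by rewrite ltr_wpDl.
Qed.

End Divergence.

(** * Lower bounds by the aligned values *)

Section LowerBound.
Variables (R : realType) (n : nat).
Local Notation C := R[i].
Implicit Types (T Q P A rho sigma : 'M[C]_n) (a b r d : 'I_n -> R).

Lemma retr_quo_expand rho sigma : rho \in unitmx ->
  retr ((rho - sigma) *m invmx rho *m (rho - sigma)) =
  retr rho - retr sigma *+ 2 + retr (sigma *m sigma *m invmx rho).
Proof.
move=> urho; rewrite mulmxBl mulmxV// mulmxBl mul1mx mulmxBr mulmxKV//.
have -> : retr (sigma *m sigma *m invmx rho) = retr (sigma *m invmx rho *m sigma).
  by rewrite /retr -[in LHS]mulmxA mxtrace_mulC.
by rewrite !retrB; ring.
Qed.

(** After expanding the square, the unitaries occur only in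
    [Tr (sigma^2 rho^-1)], where the eigenvalues [d^2] and [1 / r] are
    oppositely ordered. *)
Lemma retr_quo_ge P Q r d : P \is unitarymx -> Q \is unitarymx ->
    (forall i, 0 < r i) -> (forall i, 0 < d i) ->
    {homo r : i j / (i <= j)%N >-> j <= i} ->
    {homo d : i j / (i <= j)%N >-> j <= i} ->
  \sum_i (r i - d i) ^+ 2 / r i <=
  retr ((congdiag P r - congdiag Q d) *m invmx (congdiag P r) *m
        (congdiag P r - congdiag Q d)).
Proof.
move=> uP uQ r0 d0 homr homd; have rN0 i : r i != 0 by rewrite gt_eqF.
rewrite retr_quo_expand; last exact: congdiag_unit (unitarymx_unit uP) rN0.
rewrite (udiagV uP rN0) (udiagM _ _ uQ) !retr_udiag//.
have homd2 : {homo (fun i => d i * d i) : i j / (i <= j)%N >-> j <= i}.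
  by move=> i j /homd ij; rewrite ler_pM// ltW.
have homVr : {homo (fun i => (r i)^-1) : i j / (i <= j)%N >-> i <= j}.
  by move=> i j /homr ij; rewrite lef_pV2 ?posrE.
apply: le_trans (lerD (lexx _) (trace_rearrangement_desc uQ uP homd2 homVr)).
rewrite -sumrMnl -sumrB -big_split /= le_eqVlt; apply/orP; left; apply/eqP.
by apply: eq_bigr => i _; field.
Qed.

Lemma chi2div_ge P Q r d : P \is unitarymx -> Q \is unitarymx ->
    (forall i, 0 < r i) -> (forall i, 0 < d i) ->
    {homo r : i j / (i <= j)%N >-> j <= i} ->
    {homo d : i j / (i <= j)%N >-> j <= i} ->
  \sum_i (r i - d i) ^+ 2 / d i <= chi2div (congdiag P r) (congdiag Q d).
Proof.
move=> uP uQ r0 d0 homr homd; rewrite /chi2div -opprB mulNmx mulmxN mulNmx opprK.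
apply: le_trans (retr_quo_ge uQ uP d0 r0 homd homr).
by rewrite le_eqVlt; apply/orP; left; apply/eqP/eq_bigr => i _; rewrite -sqrrN opprB.
Qed.

(** The eigenvalues of [A + B] are majorized by the sums [a_i + b_i] of equally
    ordered eigenvalues, and [1 / t] is convex. For this function majorization
    can be bypassed: the tangent lines at the eigenvalues [c_i] of [A + B] have
    slopes [- c_i^-2], again ordered, so that rearrangement bounds the linear
    terms. *)
Lemma retr_inv_sum_le P Q a b : P \is unitarymx -> Q \is unitarymx ->
    (forall i, 0 < a i) -> (forall i, 0 < b i) ->
    {homo a : i j / (i <= j)%N >-> i <= j} ->
    {homo b : i j / (i <= j)%N >-> i <= j} ->
    posdefmx (congdiag P a + congdiag Q b) ->
  retr (invmx (congdiag P a + congdiag Q b)) <= \sum_i (a i + b i)^-1.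
Proof.
move=> uP uQ a0 b0 homa homb pAB.
have [U [c [uU ABE homc]]] := sorted_spectral (proj1 pAB).
have c0 : forall i, 0 < c i.
  by move: pAB; rewrite ABE; exact: posdefmx_gt0 (unitarymx_unit uU).
have cN0 i : c i != 0 by rewrite gt_eqF.
rewrite ABE (udiagV uU cN0) retr_udiag//.
have homz : {homo (fun i => (c i)^-1 ^+ 2) : i j / (i <= j)%N >-> j <= i}.
  move=> i j /homc ij; have Vc0 k : 0 <= (c k)^-1 by rewrite invr_ge0 ltW.
  by apply: lerXn2r; rewrite ?nnegrE ?lef_pV2 ?posrE.
(* [Z = (A + B)^-1] has eigenvalues [(c i)^-1], and [Tr (Z^2 (A + B)) = Tr Z] *)
have ZA := trace_rearrangement_desc uU uP homz homa.
have ZB := trace_rearrangement_desc uU uQ homz homb.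
have := lerD ZA ZB; rewrite -retrD -mulmxDr ABE (udiagM _ _ uU) retr_udiag//.
rewrite -big_split /= => Z.
have {}Z : \sum_i (c i)^-1 ^+ 2 * (a i + b i) <= \sum_i (c i)^-1.
  under eq_bigr do rewrite mulrDr.
  by apply: le_trans Z _; apply: ler_sum => i _; rewrite expr2 mulfVK.
have tangent i : (c i)^-1 *+ 2 - (c i)^-1 ^+ 2 * (a i + b i) <= (a i + b i)^-1.
  have t0 : 0 < a i + b i by rewrite addr_gt0.
  rewrite -subr_ge0; suff -> : (a i + b i)^-1 -
      ((c i)^-1 *+ 2 - (c i)^-1 ^+ 2 * (a i + b i)) =
      (1 - (c i)^-1 * (a i + b i)) ^+ 2 / (a i + b i).
    by rewrite divr_ge0 ?sqr_ge0 ?ltW.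
  by field; rewrite cN0 gt_eqF.
have := ler_sum (index_enum 'I_n) (fun i (_ : true) => tangent i).
by rewrite sumrB sumrMnl mulr2n; move: Z; lra.
Qed.

(** For [s > 0], dividing with remainder gives the scalar identity
    [(r - d)^2 / (r + s d) = r + d / s - ((1 + s)^2 / s) (r d / (r + s d))],
    and [r d / (r + s d) = 1 / (1 / d + s / r)] is the parallel sum to which
    [retr_inv_sum_le] applies. For matrices the identity is applied to the
    coefficients of a common congruence. At [s = 0] the parallel sum
    degenerates and the bound is [retr_quo_ge]. *)
Lemma mixdiv_ge s P Q r d : 0 <= s -> P \is unitarymx -> Q \is unitarymx ->
    (forall i, 0 < r i) -> (forall i, 0 < d i) ->
    {homo r : i j / (i <= j)%N >-> j <= i} ->
    {homo d : i j / (i <= j)%N >-> j <= i} ->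
  \sum_i (r i - d i) ^+ 2 / (r i + s * d i) <= mixdiv s (congdiag P r) (congdiag Q d).
Proof.
move=> s0 uP uQ r0 d0 homr homd; have [<-|sN0] := eqVneq 0 s.
  rewrite /mixdiv scale0r addr0; under eq_bigr do rewrite mul0r addr0.
  exact: retr_quo_ge.
have {sN0}s0 : 0 < s by rewrite lt_def eq_sym sN0.
have uniP := unitarymx_unit uP; have uniQ := unitarymx_unit uQ.
have [T [x [uT x0 rhoE sigmaE _]]] :=
  maxfdiv_pd_congdiag (posdefmx_congdiag uniP r0) (posdefmx_congdiag uniQ d0).
have rN0 i : r i != 0 by rewrite gt_eqF.
have dN0 i : d i != 0 by rewrite gt_eqF.
have xN0 i : x i != 0 by rewrite gt_eqF.
have sxN0 i : x i + s != 0 by rewrite gt_eqF// addr_gt0.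
(* this is [s rho^-1 + sigma^-1] in the dual coordinates *)
have ABE : congdiag P (fun i => s / r i) + congdiag Q (fun i => (d i)^-1) =
    congdiag ((invmx T)^t*) (fun i => (x i + s) / x i).
  rewrite -(udiagV uQ dN0) sigmaE (congdiagV uT) => [|_]; last exact: oner_neq0.
  rewrite -congdiagZ -(udiagV uP rN0) rhoE (congdiagV uT xN0) congdiagZ congdiagD.
  by apply: eq_congdiag => i; field.
have uTt : (invmx T)^t* \in unitmx by rewrite tC_unit// unitmx_inv.
have := @retr_inv_sum_le P Q (fun i => s / r i) (fun i => (d i)^-1) uP uQ.
have dualT : (invmx ((invmx T)^t*))^t* = T by rewrite -invmx_tC invmxK trmxCK.
have xsN0 i : (x i + s) / x i != 0 by rewrite mulf_neq0 ?invr_eq0.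
rewrite ABE (congdiagV uTt xsN0) dualT retr_congdiag => parallel_le.
have {}parallel_le : \sum_i x i / (x i + s) * rownormsq T i <=
    \sum_i r i * d i / (r i + s * d i).
  have -> : \sum_i r i * d i / (r i + s * d i) = \sum_i (s / r i + (d i)^-1)^-1.
    by apply: eq_bigr => i _; field; rewrite !gt_eqF ?addr_gt0 ?mulr_gt0.
  have -> : \sum_i x i / (x i + s) * rownormsq T i =
      \sum_i ((x i + s) / x i)^-1 * rownormsq T i.
    by apply: eq_bigr => i _; rewrite invf_div.
  apply: parallel_le => [i|i|i j /homr ij|i j /homd ij|].
  - by rewrite divr_gt0.
  - by rewrite invr_gt0.
  - by rewrite ler_wpM2l ?lef_pV2 ?posrE// ltW.
  - by rewrite lef_pV2 ?posrE.
  by apply: posdefmx_congdiag => // i; rewrite divr_gt0 ?addr_gt0.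
have trr : \sum_i r i = \sum_i x i * rownormsq T i.
  by rewrite -retr_congdiag -rhoE retr_udiag.
have trd : \sum_i d i = \sum_i rownormsq T i.
  rewrite -(retr_udiag _ uQ) sigmaE retr_congdiag.
  by apply: eq_bigr => i _; rewrite mul1r.
rewrite rhoE sigmaE mixdiv_congdiag => // [|i]; last by rewrite mulr1.
have -> : \sum_i (r i - d i) ^+ 2 / (r i + s * d i) = \sum_i r i + (\sum_i d i) / s
    - (1 + s) ^+ 2 / s * \sum_i r i * d i / (r i + s * d i).
  rewrite mulr_suml mulr_sumr -big_split -sumrB; apply: eq_bigr => i _ /=.
  by field; rewrite !gt_eqF ?addr_gt0 ?mulr_gt0.
have -> : \sum_i (x i - 1) ^+ 2 / (x i + s * 1) * rownormsq T i =
    \sum_i r i + (\sum_i d i) / s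
    - (1 + s) ^+ 2 / s * \sum_i x i / (x i + s) * rownormsq T i.
  rewrite trr trd mulr_suml mulr_sumr -big_split -sumrB; apply: eq_bigr => i _ /=.
  by field; rewrite !gt_eqF ?addr_gt0.
rewrite lerB// ler_wpM2l//.
by rewrite divr_ge0 ?sqr_ge0 ?ltW.
Qed.

End LowerBound.

(** * The divergence as an integral of quadratic divergences *)

Section IntegralFormula.
Variable R : realType.
Local Notation pos_itv := (`[0%R, +oo[%classic : set (measurableTypeR R)).

(** The function is monotone where the denominator is positive; freezing it for
    negative [s] makes it monotone on the whole line. *)
Lemma measurable_inv_shift (x b : R) : 0 < x -> 0 <= b ->
  measurable_fun pos_itv (fun s : R => (x + s * b)^-1).
Proof.
move=> x0 b0.
have : measurable_fun pos_itv (fun s : R => (x + Num.max 0 s * b)^-1).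
  apply: nonincreasing_measurable => [|s t st]; first exact: measurable_itv.
  have den0 (u : R) : 0 < x + Num.max 0 u * b.
    by rewrite ltr_pwDl// mulr_ge0// le_max lexx.
  rewrite lef_pV2 ?posrE// lerD2l ler_wpM2r// ge_max !le_max lexx/=.
  by rewrite st orbT.
apply: eq_measurable_fun => s; rewrite inE/= in_itv/= andbT => s0.
by rewrite max_r.
Qed.

Variables (f : R -> R) (c : R) (lam : {measure set (measurableTypeR R) -> \bar R}).
Hypothesis frepr : integral_repr f c lam.

Lemma integral_repr_sum n (x w : 'I_n -> R) :
    (forall i, 0 < x i) -> (forall i, 0 <= w i) ->
  (\sum_i f (x i) * w i)%:E =
  ((\sum_i (f 1 + derive1 f 1 * (x i - 1) + c * (x i - 1) ^+ 2) * w i)%:E +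
   \int[lam]_(s in `[0%R, +oo[)
     (\sum_i (x i - 1) ^+ 2 / (x i + s) * w i)%:E)%E.
Proof.
move=> x0 w0; have [_ _ fE] := frepr.
pose J i := (\int[lam]_(s in `[0%R, +oo[) ((x i - 1) ^+ 2 / (x i + s))%:E)%E.
have meas i : measurable_fun pos_itv (fun s => ((x i - 1) ^+ 2 / (x i + s))%:E).
  apply/measurable_EFinP/measurable_funM; first exact: measurable_cst.
  have := measurable_inv_shift (x0 i) ler01.
  by apply: eq_measurable_fun => s _; rewrite mulr1.
have ge0 i s : pos_itv s -> (0 <= ((x i - 1) ^+ 2 / (x i + s))%:E)%E.
  rewrite /= in_itv/= andbT => s0.
  by rewrite lee_fin divr_ge0 ?sqr_ge0// addr_ge0// ltW.
have JE i : J i = (f (x i) - (f 1 + derive1 f 1 * (x i - 1) + c * (x i - 1) ^+ 2))%:E.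
  by rewrite EFinB fE// addeAC subee// add0e.
have -> : (\int[lam]_(s in `[0%R, +oo[) (\sum_i (x i - 1) ^+ 2 / (x i + s) * w i)%:E =
    \sum_i (w i)%:E * J i)%E.
  under eq_integral do rewrite -sumEFin.
  rewrite ge0_integral_sum//.
  - apply: eq_bigr => i _; rewrite -ge0_integralZl_EFin//.
      by apply: eq_integral => s _; rewrite -EFinM mulrC.
    by move=> s; exact: ge0.
  - move=> i; apply: (@eq_measurable_fun _ _ _ _ _
      (fun s : measurableTypeR R => (w i)%:E * ((x i - 1) ^+ 2 / (x i + s))%:E)%E).
      by move=> s _; rewrite -EFinM mulrC.
    exact: (measurable_funeM _ (meas i)).
  - by move=> i s Ds; rewrite EFinM mule_ge0// ?ge0// lee_fin.
under [X in (_ + X)%E]eq_bigr do rewrite JE -EFinM.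
rewrite sumEFin -EFinD -big_split; congr EFin; apply: eq_bigr => i _ /=.
by ring.
Qed.

(** Both sides are combinations of scalar functions of the coefficients [x]
    of a common congruence, with the same weights. *)
Lemma maxfdiv_pd_integral n (rho sigma : 'M[R[i]]_n) :
    posdefmx rho -> posdefmx sigma ->
  (maxfdiv_pd f rho sigma)%:E =
  ((f 1 * retr sigma + derive1 f 1 * (retr rho - retr sigma)
    + c * chi2div rho sigma)%:E +
   \int[lam]_(s in `[0%R, +oo[) (mixdiv s rho sigma)%:E)%E.
Proof.
move=> prho psigma.
have [T [x [uT x0 rhoE sigmaE ->]]] := maxfdiv_pd_congdiag prho psigma.
rewrite integral_repr_sum//; last by move=> i; exact: rownormsq_ge0.
congr (_ + _)%E.
  rewrite rhoE sigmaE chi2div_congdiag// !retr_congdiag -sumrB !mulr_sumr -!big_split.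
  congr EFin; apply: eq_bigr => i _ /=; rewrite divr1; ring.
apply: eq_integral => s; rewrite inE/= in_itv/= andbT => s0.
rewrite rhoE sigmaE mixdiv_congdiag// => [|i].
  by congr EFin; apply: eq_bigr => i _; rewrite mulr1.
by rewrite mulr1 gt_eqF// ltr_pwDl.
Qed.

Lemma measurable_mixdiv n (rho sigma : 'M[R[i]]_n) :
    posdefmx rho -> posdefmx sigma ->
  measurable_fun pos_itv (fun s => (mixdiv s rho sigma)%:E).
Proof.
move=> prho psigma.
have [T [x [uT x0 -> -> _]]] := maxfdiv_pd_congdiag prho psigma.
apply/measurable_EFinP.
have : measurable_fun pos_itv
    (fun s => \sum_i (x i - 1) ^+ 2 / (x i + s * 1) * rownormsq T i).
  apply: measurable_sum => i.
  apply: measurable_funM; last exact: measurable_cst.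
  apply: measurable_funM; first exact: measurable_cst.
  exact: measurable_inv_shift (x0 i) ler01.
apply: eq_measurable_fun => s; rewrite inE/= in_itv/= andbT => s0.
by rewrite mixdiv_congdiag// => i; rewrite mulr1 gt_eqF// ltr_pwDl.
Qed.

Lemma mixdiv_ge0 n (rho sigma : 'M[R[i]]_n) s :
  posdefmx rho -> posdefmx sigma -> 0 <= s -> 0 <= mixdiv s rho sigma.
Proof.
move=> prho psigma s0.
have [T [x [uT x0 -> -> _]]] := maxfdiv_pd_congdiag prho psigma.
have xs0 i : 0 < x i + s * 1 by rewrite mulr1 ltr_pwDl.
rewrite mixdiv_congdiag// => [|i]; last by rewrite gt_eqF.
by apply: sumr_ge0 => i _; rewrite mulr_ge0 ?rownormsq_ge0// divr_ge0 ?sqr_ge0 ?ltW.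
Qed.

End IntegralFormula.

(** * Quotients with values in the extended reals *)

Section ExtendedQuotient.
Variable R : realType.
Implicit Types y z : R.

(** For [y] and [z] nonnegative this is the limit of [y / (z + e)] as [e]
    decreases to [0]; the convention [0 / 0 = 0] is forced by this. *)
Definition quoe y z : \bar R :=
  if z == 0 then if y == 0 then 0%E else +oo%E else (y / z)%:E.

Lemma quoe_ge0 y z : 0 <= y -> 0 <= z -> (0 <= quoe y z)%E.
Proof.
move=> y0 z0; rewrite /quoe; case: ifP => _; last by rewrite lee_fin divr_ge0.
by case: ifP => // _; rewrite leey.
Qed.

Lemma quoe0 z : quoe 0 z = 0%E.
Proof. by rewrite /quoe eqxx mul0r; case: ifP. Qed.

Lemma quoeE y z : z != 0 -> quoe y z = (y / z)%:E.
Proof. by rewrite /quoe => /negbTE->. Qed.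

Lemma quoeD y1 y2 z : 0 <= y1 -> 0 <= y2 ->
  quoe (y1 + y2) z = (quoe y1 z + quoe y2 z)%E.
Proof.
move=> y10 y20; rewrite /quoe; case: ifP => _; last by rewrite mulrDl.
rewrite paddr_eq0//; case: (y1 == 0); case: (y2 == 0) => //=; by rewrite ?add0e.
Qed.

Lemma quoe_scale k y z : k != 0 -> quoe (y * k) (z * k) = quoe y z.
Proof.
move=> k0; rewrite /quoe !mulf_eq0 (negbTE k0) !orbF; case: ifP => // /negbT z0.
by rewrite -mulf_div divff// mulr1.
Qed.

Lemma cvg_EFin_comp (T : Type) (F : set_system T) (FF : Filter F) (g : T -> R) l :
  g @ F --> l -> (g t)%:E @[t --> F] --> l%:E.
Proof. by move=> gl; apply: cvg_EFin; [exact: nearW|exact: gl]. Qed.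

Lemma cvg_quoe (T : Type) (F : set_system T) (FF : ProperFilter F) (y z : T -> R) y0 z0 :
  z0 != 0 -> y @ F --> y0 -> z @ F --> z0 ->
  quoe (y t) (z t) @[t --> F] --> quoe y0 z0.
Proof.
move=> z00 yy zz; rewrite quoeE//.
apply: (@cvg_trans _ ((y t / z t)%:E @[t --> F])).
  have zt0 : \forall t \near F, z t != 0 by exact: (cvgr_neq0 _ zz).
  by apply: near_eq_cvg; apply: filterS zt0 => t zt; rewrite quoeE.
apply: cvg_EFin_comp.
by apply: cvgM => //; exact: cvgV.
Qed.

(** Stated for an arbitrary filter, to be used for the right neighborhoods of
    [0] and for sequences. *)
Lemma cvg_quoe_regularized (T : Type) (F : set_system T) (FF : ProperFilter F)
    (e : T -> R) y z : 0 <= y -> 0 <= z ->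
  (\forall t \near F, 0 < e t) -> e @ F --> 0 ->
  (y / (z + e t))%:E @[t --> F] --> quoe y z.
Proof.
move=> y0 z0 e0 ecvg; have [zE|zN0] := eqVneq z 0; last first.
  rewrite quoeE//; apply: cvg_EFin_comp.
  apply: cvgM; first exact: cvg_cst.
  apply: cvgV => //; rewrite -[X in _ --> X]addr0.
  by apply: cvgD => //; exact: cvg_cst.
rewrite zE; have [yE|yN0] := eqVneq y 0.
  by rewrite yE quoe0; under eq_fun do rewrite mul0r; exact: cvg_cst.
rewrite /quoe eqxx (negbTE yN0); apply/cvgeyPge => A.
have y_gt0 : 0 < y by rewrite lt_def yN0.
have A0 : 0 < Num.max A 1 by rewrite lt_max ltr01 orbT.
have small : \forall t \near F, e t < y / Num.max A 1.
  by apply: (cvgr_lt 0) => //; rewrite divr_gt0.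
apply: filterS2 e0 small => t et0 /ltW et; rewrite lee_fin add0r ler_pdivlMr//.
apply: (@le_trans _ _ (Num.max A 1 * e t)).
  by rewrite ler_pM2r// le_max lexx.
by rewrite mulrC -ler_pdivlMr.
Qed.

Lemma cvg_const_at_right0 (g : R -> \bar R) (l : \bar R) :
  (forall e, 0 < e -> g e = l) -> g e @[e --> (0 : R)^'+] --> l.
Proof.
move=> gl; apply: (@cvg_trans _ (l @[_ --> (0 : R)^'+])); last exact: cvg_cst.
by apply: near_eq_cvg; apply: filterS (nbhs_right_gt (0 : R)) => e /gl.
Qed.

Lemma cvg_id_at_right0 : e @[e --> (0 : R)^'+] --> (0 : R).
Proof. exact: cvg_at_right_filter. Qed.

End ExtendedQuotient.

(** * The regularized traces of diagonal matrices *)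

Section ReprFormula.
Variables (R : realType) (n : nat).
Implicit Types (a b r d : 'I_n -> R).

Lemma rdiag_shiftV b (e : R) : (forall i, 0 <= b i) -> 0 < e ->
  invmx (rdiag b + (e%:C)%:M) = rdiag (fun i => (b i + e)^-1).
Proof.
by move=> b0 e0; rewrite -rdiag_const rdiagD rdiagV// => i; rewrite gt_eqF// ltr_wpDl.
Qed.

Lemma trquo_rdiag a b : (forall i, 0 <= a i) -> (forall i, 0 <= b i) ->
  trquo (rdiag a) (rdiag b) = (\sum_i quoe (a i) (b i))%E.
Proof.
move=> a0 b0; apply: cvg_lim => //.
apply: (@cvg_trans _ ((\sum_i (a i / (b i + e))%:E)%E @[e --> (0:R)^'+])).
  apply: near_eq_cvg; have := nbhs_right_gt (0 : R); apply: filterS => e e0.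
  by rewrite rdiag_shiftV// rdiagM retr_rdiag sumEFin.
apply: cvg_nnesum => i _.
  have := nbhs_right_gt (0 : R); apply: filterS => e e0.
  by rewrite lee_fin divr_ge0// addr_ge0// ltW.
apply: cvg_quoe_regularized => //; first exact: nbhs_right_gt.
exact: cvg_id_at_right0.
Qed.

(** For a fixed outer regularization [e] the inner limit is a sum of quotients
    by [r i / (d i + e) + s]; multiplying numerators and denominators by
    [d i + e > 0] removes the inverse of [d] before the outer limit is
    taken. *)
Lemma via_inv_trquo (N : 'M[R[i]]_n -> 'M[R[i]]_n) (num : R -> 'I_n -> R)
    (l : 'I_n -> \bar R) r d s :
    (forall i, 0 <= r i) -> (forall i, 0 <= d i) -> 0 <= s ->
    (forall e, 0 < e -> N (rdiag (fun i => (d i + e)^-1)) = rdiag (num e)) ->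
    (forall e i, 0 < e -> 0 <= num e i) ->
    (forall i, quoe (num e i * (d i + e)) (r i + s * (d i + e))
       @[e --> (0 : R)^'+] --> l i) ->
  via_inv (rdiag d) (fun Di => trquo (N Di) (Di *m rdiag r + (s%:C)%:M)) =
  (\sum_i l i)%E.
Proof.
move=> r0 d0 s0 NE num0 ncvg; apply: cvg_lim => //.
apply: (@cvg_trans _ ((\sum_i quoe (num e i * (d i + e)) (r i + s * (d i + e)))%E
    @[e --> (0:R)^'+])).
  apply: near_eq_cvg; have := nbhs_right_gt (0 : R); apply: filterS => e e0.
  have de0 i : 0 < d i + e by rewrite ltr_wpDl.
  rewrite rdiag_shiftV// NE// rdiagM -rdiag_const rdiagD trquo_rdiag//.
  - apply: eq_bigr => i _; have deN0 : d i + e != 0 by rewrite gt_eqF.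
    have -> : r i + s * (d i + e) = ((d i + e)^-1 * r i + s) * (d i + e).
      by rewrite mulrDl mulrAC mulVf// mul1r.
    by rewrite quoe_scale.
  - by move=> i; exact: num0.
  - by move=> i; rewrite addr_ge0// mulr_ge0// invr_ge0 ltW.
apply: cvg_nnesum => i _; last exact: ncvg.
have := nbhs_right_gt (0 : R); apply: filterS => e e0.
have de0 : 0 < d i + e by rewrite ltr_wpDl.
by rewrite quoe_ge0// ?mulr_ge0 ?num0// ?addr_ge0// ?mulr_ge0// ltW.
Qed.

Lemma cvg_addr_at_right0 (x : R) : x + e @[e --> (0 : R)^'+] --> x.
Proof.
rewrite -[X in _ --> X]addr0; apply: cvgD; first exact: cvg_cst.
exact: cvg_id_at_right0.
Qed.

Lemma cvg_shifted_den_at_right0 (r s d : R) :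
  r + s * (d + e) @[e --> (0 : R)^'+] --> r + s * d.
Proof.
apply: cvgD; first exact: cvg_cst.
by apply: cvgM; [exact: cvg_cst|exact: cvg_addr_at_right0].
Qed.

Lemma addr_mul_eq0 (r s d : R) : 0 <= r -> 0 <= s -> 0 <= d ->
  r + s * d = 0 -> r = 0 /\ (s = 0 \/ d = 0).
Proof.
move=> r0 s0 d0 /eqP; rewrite paddr_eq0 ?mulr_ge0// mulf_eq0.
by move=> /andP[/eqP-> /orP[]/eqP->]; split => //; [left|right].
Qed.

(** In this lemma and the next two, a vanishing denominator [r i + s * d i]
    forces [r i = 0] and [s = 0] or [d i = 0]; then the regularized quotient
    does not depend on [e]. Otherwise the quotient is continuous. *)
Lemma via_inv_trquo_RR r d s :
    (forall i, 0 <= r i) -> (forall i, 0 <= d i) -> 0 <= s ->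
  via_inv (rdiag d) (fun Di => trquo (Di *m (rdiag r *m rdiag r))
     (Di *m rdiag r + (s%:C)%:M)) = (\sum_i quoe (r i ^+ 2) (r i + s * d i))%E.
Proof.
move=> r0 d0 s0.
apply: (via_inv_trquo (N := fun Di => Di *m (rdiag r *m rdiag r))
   (num := fun e i => (d i + e)^-1 * (r i * r i))) => // [e e0|e i e0|i].
- by rewrite !rdiagM.
- by rewrite mulr_ge0 ?mulr_ge0// invr_ge0 addr_ge0// ltW.
apply: (@cvg_trans _ (quoe (r i ^+ 2) (r i + s * (d i + e)) @[e --> (0:R)^'+])).
  apply: near_eq_cvg; have := nbhs_right_gt (0 : R); apply: filterS => e e0.
  by rewrite mulrAC mulVf ?mul1r// gt_eqF// ltr_wpDl.
have [/addr_mul_eq0 z0|zN0] := eqVneq (r i + s * d i) 0.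
  case: (z0 (r0 i) s0 (d0 i)) => -> _.
  by apply: cvg_const_at_right0 => e _; rewrite expr0n/= !quoe0.
by apply: cvg_quoe => //; [exact: cvg_cst|exact: cvg_shifted_den_at_right0].
Qed.

Lemma via_inv_trquo_R r d s :
    (forall i, 0 <= r i) -> (forall i, 0 <= d i) -> 0 <= s ->
  via_inv (rdiag d) (fun Di => trquo (rdiag r)
     (Di *m rdiag r + (s%:C)%:M)) = (\sum_i quoe (r i * d i) (r i + s * d i))%E.
Proof.
move=> r0 d0 s0.
apply: (via_inv_trquo (N := fun=> rdiag r) (num := fun=> r)) => // i.
have [/addr_mul_eq0 z0|zN0] := eqVneq (r i + s * d i) 0.
  case: (z0 (r0 i) s0 (d0 i)) => -> _.
  by apply: cvg_const_at_right0 => e _; rewrite !mul0r !quoe0.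
apply: cvg_quoe => //; last exact: cvg_shifted_den_at_right0.
by apply: cvgMl_tmp; exact: cvg_addr_at_right0.
Qed.

Lemma via_inv_trquo_D r d s :
    (forall i, 0 <= r i) -> (forall i, 0 <= d i) -> 0 <= s ->
  via_inv (rdiag d) (fun Di => trquo (rdiag d)
     (Di *m rdiag r + (s%:C)%:M)) = (\sum_i quoe (d i ^+ 2) (r i + s * d i))%E.
Proof.
move=> r0 d0 s0.
apply: (via_inv_trquo (N := fun=> rdiag d) (num := fun=> d)) => // i.
have [/addr_mul_eq0 z0|zN0] := eqVneq (r i + s * d i) 0; last first.
  apply: cvg_quoe => //; last exact: cvg_shifted_den_at_right0.
  by rewrite expr2; apply: cvgMl_tmp; exact: cvg_addr_at_right0.
case: (z0 (r0 i) s0 (d0 i)) => -> sd0.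
have [->|dN0] := eqVneq (d i) 0.
  by apply: cvg_const_at_right0 => e _; rewrite expr0n/= mul0r !quoe0.
case: sd0 => [->|/eqP]; last by rewrite (negbTE dN0).
apply: cvg_const_at_right0 => e e0.
by rewrite !mul0r !addr0 /quoe !eqxx sqrf_eq0 mulf_eq0 (negbTE dN0)/= gt_eqF// ltr_wpDl.
Qed.

End ReprFormula.

(** * The value of the integral expression *)

Section ReprValue.
Variable R : realType.
Local Notation pos_itv := (`[0%R, +oo[%classic : set (measurableTypeR R)).

Lemma cvg_quoe_harmonic (y r d s : R) : 0 <= y -> 0 <= r -> 0 <= d -> 0 <= s ->
  (y * ((r + harmonic k) + s * (d + harmonic k))^-1)%:E @[k --> \oo] -->
  quoe y (r + s * d).
Proof.
move=> y0 r0 d0 s0.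
have -> : (fun k => (y * ((r + harmonic k) + s * (d + harmonic k))^-1)%:E) =
    (fun k => (y / (r + s * d + (1 + s) * harmonic k))%:E).
  by apply/funext => k; congr (_ / _)%:E; ring.
apply: cvg_quoe_regularized => //; first by rewrite addr_ge0 ?mulr_ge0.
  by apply: nearW => k; rewrite mulr_gt0 ?harmonic_gt0// ltr_pwDl.
rewrite -(mulr0 (1 + s)); apply: cvgMl_tmp; exact: cvg_harmonic.
Qed.

(** A pointwise limit of quotients with positive denominators. *)
Lemma measurable_quoe_affine (y r d : R) : 0 <= y -> 0 <= r -> 0 <= d ->
  measurable_fun pos_itv (fun s => quoe y (r + s * d)).
Proof.
move=> y0 r0 d0; apply: (emeasurable_fun_cvg
  (fun k (s : measurableTypeR R) =>
    (y * ((r + harmonic k) + s * (d + harmonic k))^-1)%:E)).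
  move=> k; apply/measurable_EFinP/measurable_funM; first exact: measurable_cst.
  by apply: measurable_inv_shift; rewrite ?ltr_wpDl ?addr_ge0 ?harmonic_ge0 ?harmonic_gt0.
by move=> s; rewrite /= in_itv/= andbT => s0; exact: cvg_quoe_harmonic.
Qed.

(** In the extended reals the cross term can be cancelled because it is finite;
    the other terms may be [+oo]. *)
Lemma regroup_cross_term (a b x y z w : \bar R) : y \is a fin_num ->
  (x + z = w + (y + y) -> a + b + x - 2%:E * y + z = a + (b + w))%E.
Proof.
case: y => // y _ xz; rewrite -!addeA; congr (_ + (_ + _))%E.
rewrite addeCA xz addeCA -EFinM -EFinN -!EFinD.
by rewrite (_ : - (2 * y) + (y + y) = 0) ?adde0//; ring.
Qed.

Variables (n : nat) (r d : 'I_n -> R).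
Hypotheses (r0 : forall i, 0 <= r i) (d0 : forall i, 0 <= d i).
Variables (f : R -> R) (c : R) (lam : {measure set (measurableTypeR R) -> \bar R}).
Hypothesis frepr : integral_repr f c lam.

Let int (y : 'I_n -> R) :=
  (\int[lam]_(s in `[0%R, +oo[) (\sum_i quoe (y i) (r i + s * d i)))%E.

Lemma sum_quoe_ge0 (y : 'I_n -> R) s : (forall i, 0 <= y i) -> 0 <= s ->
  (0 <= \sum_i quoe (y i) (r i + s * d i))%E.
Proof.
by move=> y0 s0; apply: sume_ge0 => i _; rewrite quoe_ge0// addr_ge0// mulr_ge0.
Qed.

Lemma measurable_sum_quoe (y : 'I_n -> R) : (forall i, 0 <= y i) ->
  measurable_fun pos_itv (fun s => \sum_i quoe (y i) (r i + s * d i))%E.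
Proof.
by move=> y0; apply: emeasurable_sum => i; exact: measurable_quoe_affine.
Qed.

Lemma int_quoe_ge0 (y : 'I_n -> R) : (forall i, 0 <= y i) -> (0 <= int y)%E.
Proof.
move=> y0; apply: integral_ge0 => s; rewrite /= in_itv/= andbT => s0.
exact: sum_quoe_ge0.
Qed.

Lemma int_quoeD (y1 y2 : 'I_n -> R) : (forall i, 0 <= y1 i) -> (forall i, 0 <= y2 i) ->
  int (fun i => y1 i + y2 i) = (int y1 + int y2)%E.
Proof.
move=> y10 y20; rewrite /int -ge0_integralD//.
- by apply: eq_integral => s _; rewrite -big_split; apply: eq_bigr => i _; rewrite quoeD.
- by move=> s; rewrite /= in_itv/= andbT => s0; exact: sum_quoe_ge0.
- exact: measurable_sum_quoe.
- by move=> s; rewrite /= in_itv/= andbT => s0; exact: sum_quoe_ge0.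
- exact: measurable_sum_quoe.
Qed.

(** Clearing denominators,
    [(a + b) (a + s b) - a b (1 + s) = a^2 + s b^2 >= 0]. *)
Lemma quoe_cross_le (a b s : R) : 0 <= a -> 0 <= b -> 0 <= s ->
  (quoe (a * b) (a + s * b) <= ((a + b) * (1 + s)^-1)%:E)%E.
Proof.
move=> a0 b0 s0; have s1 : 0 < 1 + s by rewrite ltr_pwDl.
have [ab0|ab0] := eqVneq (a * b) 0.
  by rewrite ab0 quoe0 lee_fin divr_ge0 ?addr_ge0.
have a_gt0 : 0 < a by rewrite lt_def a0 andbT; apply: contra_neq ab0 => ->; rewrite mul0r.
have den0 : 0 < a + s * b by rewrite ltr_pwDl// mulr_ge0.
rewrite quoeE ?gt_eqF// lee_fin ler_pdivrMr// mulrAC ler_pdivlMr//.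
rewrite -subr_ge0 (_ : _ - _ = a ^+ 2 + s * b ^+ 2); last by ring.
by rewrite addr_ge0 ?mulr_ge0 ?sqr_ge0.
Qed.

Lemma int_quoe_cross_fin : int (fun i => r i * d i) \is a fin_num.
Proof.
have rd0 i : 0 <= r i * d i by rewrite mulr_ge0.
rewrite ge0_fin_numE; last exact: int_quoe_ge0.
have [_ finlam _] := frepr.
have [q qE] : exists q, (\int[lam]_(s in `[0%R, +oo[) ((1 + s)^-1)%:E)%E = q%:E.
  exists (fine (\int[lam]_(s in `[0%R, +oo[) ((1 + s)^-1)%:E)%E).
  rewrite fineK// ge0_fin_numE//; apply: integral_ge0 => s.
  by rewrite /= in_itv/= andbT => s0; rewrite lee_fin invr_ge0 addr_ge0.
have mV : measurable_fun pos_itv (fun s => ((1 + s)^-1)%:E).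
  apply/measurable_EFinP; have := measurable_inv_shift (@ltr01 R) (@ler01 R).
  by apply: eq_measurable_fun => s _; rewrite mulr1.
pose M := \sum_i (r i + d i).
have M0 : 0 <= M by apply: sumr_ge0 => i _; rewrite addr_ge0.
apply: (@le_lt_trans _ _ (\int[lam]_(s in `[0%R, +oo[) (M%:E * ((1 + s)^-1)%:E))%E).
  apply: ge0_le_integral => //.
  - by move=> s; rewrite /= in_itv/= andbT => s0; exact: sum_quoe_ge0.
  - exact: measurable_sum_quoe.
  - exact: measurable_funeM.
  move=> s; rewrite /= in_itv/= andbT => s0.
  rewrite -EFinM /M mulr_suml -sumEFin; apply: lee_sum => i _.
  exact: quoe_cross_le.
rewrite ge0_integralZl_EFin//; first by rewrite qE -EFinM ltry.
by move=> s; rewrite /= in_itv/= andbT => s0; rewrite lee_fin invr_ge0 addr_ge0.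
Qed.

(** The limit of the divergences of the aligned pair, term by term. *)
Definition repr_value : \bar R :=
  ((f 1)%:E + (c%:E * (\sum_i quoe ((r i - d i) ^+ 2)%R (d i)) +
    int (fun i => (r i - d i) ^+ 2)%R))%E.

(** Termwise [r^2 / d = (r - d)^2 / d + (2 r - d)], also for [d = 0], and the
    finite corrections add up to [2 - 1]. *)
Lemma sum_quoe_chi2 : \sum_i r i = 1 -> \sum_i d i = 1 ->
  (\sum_i quoe (r i * r i)%R (d i) - 1 = \sum_i quoe ((r i - d i) ^+ 2)%R (d i))%E.
Proof.
move=> r1 d1.
have quoe_sq i : quoe (r i * r i) (d i) =
    (quoe ((r i - d i) ^+ 2)%R (d i) + (2 * r i - d i)%R%:E)%E.
  rewrite /quoe; have [->|dN0] := eqVneq (d i) 0; last first.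
    by rewrite -EFinD; congr EFin; field.
  rewrite !subr0 !mulf_eq0 !orbb.
  by case: eqP => [->|_]; rewrite ?mulr0 ?add0e.
under eq_bigr do rewrite quoe_sq.
rewrite big_split /= sumEFin sumrB -mulr_sumr r1 d1.
have -> : 2 * 1 - 1 = 1 :> R by ring.
by rewrite addeK.
Qed.

(** All three integrands have the same denominators, and
    [r^2 + d^2 = (r - d)^2 + 2 r d]. *)
Lemma repr_maxfdivE : \sum_i r i = 1 -> \sum_i d i = 1 ->
  repr_maxfdiv f c lam (rdiag r) (rdiag d) = repr_value.
Proof.
move=> r1 d1.
have sq0 (x : R) : 0 <= x ^+ 2 by exact: sqr_ge0.
have rd0 i : 0 <= r i * d i by rewrite mulr_ge0.
have cE : (trquo (rdiag r *m rdiag r) (rdiag d) - 1 =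
    \sum_i quoe ((r i - d i) ^+ 2)%R (d i))%E.
  rewrite rdiagM trquo_rdiag// => [|i]; last exact: mulr_ge0.
  exact: sum_quoe_chi2.
transitivity ((f 1)%:E + c%:E * (\sum_i quoe ((r i - d i) ^+ 2)%R (d i)) +
    int (fun i => r i ^+ 2)%R - 2%:E * int (fun i => r i * d i)%R +
    int (fun i => d i ^+ 2)%R)%E.
  rewrite /repr_maxfdiv cE; congr (_ + _ - 2%:E * _ + _)%E.
  - apply: eq_integral => s; rewrite inE/= in_itv/= andbT => s0.
    exact: via_inv_trquo_RR.
  - apply: eq_integral => s; rewrite inE/= in_itv/= andbT => s0.
    exact: via_inv_trquo_R.
  - apply: eq_integral => s; rewrite inE/= in_itv/= andbT => s0.
    exact: via_inv_trquo_D.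
have intE : (int (fun i => r i ^+ 2)%R + int (fun i => d i ^+ 2)%R =
    int (fun i => (r i - d i) ^+ 2)%R +
    (int (fun i => r i * d i)%R + int (fun i => r i * d i)%R))%E.
  rewrite -!int_quoeD// => [|i]; last by rewrite addr_ge0.
  apply: eq_integral => s _; apply: eq_bigr => i _; congr quoe; ring.
exact: regroup_cross_term int_quoe_cross_fin intE.
Qed.

End ReprValue.

(** * The limit of the regularized divergences *)

Section Regularization.
Variables (R : realType) (n : nat).
Implicit Types (rho sigma A : 'M[R[i]]_n) (r d : 'I_n -> R) (e s : R).
Local Notation pos_itv := (`[0%R, +oo[%classic : set (measurableTypeR R)).

Lemma congdiag_shift Q r e : Q \is unitarymx ->
  congdiag Q r + (e%:C)%:M = congdiag Q (fun i => r i + e).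
Proof. by move=> uQ; rewrite -(udiag_scalar _ uQ) congdiagD. Qed.

Lemma psdmx_shift_posdef rho e : psdmx rho -> 0 < e -> posdefmx (rho + (e%:C)%:M).
Proof.
move=> prho e0; have [Q [m [uQ rhoE _]]] := sorted_spectral (proj1 prho).
rewrite rhoE in prho *; have m0 := psdmx_ge0 (unitarymx_unit uQ) prho.
rewrite congdiag_shift//; apply: posdefmx_congdiag (unitarymx_unit uQ) _ => i.
by rewrite ltr_wpDl.
Qed.

Lemma psdmxDZ rho sigma s : psdmx rho -> psdmx sigma -> 0 <= s ->
  psdmx (rho + s%:C *: sigma).
Proof.
move=> [hr pr] [hs ps] s0; split.
  move: hr hs; rewrite !hermsymmx_tC => /eqP hr /eqP hs; apply/eqP/matrixP => i j.
  have /matrixP/(_ i j) := hr; have /matrixP/(_ i j) := hs.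
  by rewrite !mxE rmorphD rmorphM => -> ->; congr (_ + _ * _); exact/esym/conjC_real.
move=> u; rewrite mulmxDr mulmxDl -scalemxAr -scalemxAl.
move: (pr u) (ps u) => {}pr {}ps.
have entryE (X Y : 'M[R[i]]_1) : (X + s%:C *: Y) 0 0 = X 0 0 + s%:C * Y 0 0.
  by rewrite !mxE.
by rewrite entryE addr_ge0// mulr_ge0// lecR.
Qed.

Lemma shift_subr rho sigma e :
  (rho + (e%:C)%:M) - (sigma + (e%:C)%:M) = rho - sigma.
Proof. by rewrite opprD addrACA subrr addr0. Qed.

Lemma retr_shift sigma e : retr (sigma + (e%:C)%:M) = retr sigma + e * n%:R.
Proof.
by rewrite retrD -rdiag_const retr_rdiag sumr_const card_ord mulr_natr.
Qed.

Lemma herm_subr_tC rho sigma : psdmx rho -> psdmx sigma ->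
  (rho - sigma)^t* = rho - sigma.
Proof.
move=> [+ _] [+ _]; rewrite !hermsymmx_tC => /eqP hr /eqP hs.
apply/matrixP => i j; have /matrixP/(_ i j) := hr; have /matrixP/(_ i j) := hs.
by rewrite !mxE rmorphB => -> ->.
Qed.

(** Adding [e I] to both states does not change their difference and adds
    [(1 + s) e I] to [rho + s sigma]. *)
Lemma mixdiv_shift_antitone rho sigma s e e' : psdmx rho -> psdmx sigma ->
    0 <= s -> 0 < e -> e <= e' ->
  mixdiv s (rho + (e'%:C)%:M) (sigma + (e'%:C)%:M) <=
  mixdiv s (rho + (e%:C)%:M) (sigma + (e%:C)%:M).
Proof.
move=> prho psigma s0 e0 ee'.
have den k : rho + (k%:C)%:M + s%:C *: (sigma + (k%:C)%:M) =
    (rho + s%:C *: sigma) + (((1 + s) * k)%:C)%:M.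
  rewrite scalerDr addrACA; congr (_ + _).
  by rewrite scale_scalar_mx -raddfD /= -rmorphM -rmorphD mulrDl mul1r.
rewrite /mixdiv !shift_subr !den -{1 3}(herm_subr_tC prho psigma).
have s1 : 0 < 1 + s by rewrite ltr_pwDl.
apply: regularized_inverse_antitone; first exact: psdmxDZ.
  by rewrite mulr_gt0.
by rewrite ler_pM2l.
Qed.

Lemma chi2div_shift_antitone rho sigma e e' : psdmx rho -> psdmx sigma ->
    0 < e -> e <= e' ->
  chi2div (rho + (e'%:C)%:M) (sigma + (e'%:C)%:M) <=
  chi2div (rho + (e%:C)%:M) (sigma + (e%:C)%:M).
Proof.
move=> prho psigma e0 ee'.
rewrite /chi2div !shift_subr -{1 3}(herm_subr_tC prho psigma).
exact: regularized_inverse_antitone.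
Qed.

Variables (f : R -> R) (c : R) (lam : {measure set (measurableTypeR R) -> \bar R}).
Hypothesis frepr : integral_repr f c lam.

(** The terms of the integral formula that remain, besides the constant one,
    for states of equal trace. *)
Let quadratic_part rho sigma : \bar R := ((c * chi2div rho sigma)%:E +
   \int[lam]_(s in `[0%R, +oo[) (mixdiv s rho sigma)%:E)%E.

Lemma maxfdiv_pd_shift rho sigma e : psdmx rho -> psdmx sigma ->
    retr rho = retr sigma -> 0 < e ->
  (maxfdiv_pd f (rho + (e%:C)%:M) (sigma + (e%:C)%:M))%:E =
  ((f 1 * (retr sigma + e * n%:R))%:E +
   quadratic_part (rho + (e%:C)%:M) (sigma + (e%:C)%:M))%E.
Proof.
move=> prho psigma trE e0.
rewrite (maxfdiv_pd_integral frepr (psdmx_shift_posdef prho e0)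
  (psdmx_shift_posdef psigma e0)) !retr_shift trE.
rewrite subrr mulr0 addr0 EFinD; exact/esym/addeA.
Qed.

Lemma quadratic_part_antitone rho sigma e e' : psdmx rho -> psdmx sigma ->
    0 < e -> e <= e' ->
  (quadratic_part (rho + (e'%:C)%:M) (sigma + (e'%:C)%:M) <=
   quadratic_part (rho + (e%:C)%:M) (sigma + (e%:C)%:M))%E.
Proof.
move=> prho psigma e0 ee'; have [c0 _ _] := frepr.
have e'0 := lt_le_trans e0 ee'.
apply: leeD.
  by rewrite lee_fin ler_wpM2l// chi2div_shift_antitone.
apply: ge0_le_integral => //.
- move=> s; rewrite /= in_itv/= andbT => s0; rewrite lee_fin.
  by apply: mixdiv_ge0 s0; exact: psdmx_shift_posdef.
- by apply: measurable_mixdiv; exact: psdmx_shift_posdef.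
- by apply: measurable_mixdiv; exact: psdmx_shift_posdef.
move=> s; rewrite /= in_itv/= andbT => s0; rewrite lee_fin.
exact: mixdiv_shift_antitone.
Qed.

(** A continuous term plus one that is monotone in [e]. *)
Lemma is_cvg_maxfdiv rho sigma : psdmx rho -> psdmx sigma -> retr rho = retr sigma ->
  cvg ((maxfdiv_pd f (rho + (e%:C)%:M) (sigma + (e%:C)%:M))%:E @[e --> (0:R)^'+]).
Proof.
move=> prho psigma trE.
pose g e := quadratic_part (rho + (e%:C)%:M) (sigma + (e%:C)%:M).
have cg : cvg (g e @[e --> (0:R)^'+]).
  apply: nonincreasing_at_right_is_cvge; apply: nearW => x e e'.
  rewrite !in_itv/= => /andP[e0 _] _ ee'; exact: quadratic_part_antitone.
have cf : (f 1 * (retr sigma + e * n%:R))%:E @[e --> (0:R)^'+] -->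
    (f 1 * (retr sigma + 0 * n%:R))%:E.
  apply: cvg_EFin_comp; apply: cvgMl_tmp; apply: cvgD; first exact: cvg_cst.
  apply: cvgMr_tmp; exact: cvg_id_at_right0.
have ad : ((f 1 * (retr sigma + 0 * n%:R))%:E +? lim (g e @[e --> (0:R)^'+]))%E.
  exact: fin_num_adde_defr.
apply/cvg_ex; exists ((f 1 * (retr sigma + 0 * n%:R))%:E + lim (g e @[e --> (0:R)^'+]))%E.
apply: (@cvg_trans _ (((f 1 * (retr sigma + e * n%:R))%:E + g e)%E @[e --> (0:R)^'+])).
  apply: near_eq_cvg; apply: filterS (nbhs_right_gt (0 : R)) => e e0.
  by rewrite maxfdiv_pd_shift.
exact: cvgeD ad cf cg.
Qed.

Section Aligned.
Variables (r d : 'I_n -> R).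
Hypotheses (r0 : forall i, 0 <= r i) (d0 : forall i, 0 <= d i).
Hypotheses (r1 : \sum_i r i = 1) (d1 : \sum_i d i = 1).
Variable P : 'M[R[i]]_n.
Hypothesis uP : P \is unitarymx.

Lemma mixdiv_udiag s e : 0 <= s -> 0 < e ->
  mixdiv s (congdiag P r + (e%:C)%:M) (congdiag P d + (e%:C)%:M) =
  \sum_i (r i - d i) ^+ 2 * ((r i + e) + s * (d i + e))^-1.
Proof.
move=> s0 e0; rewrite !congdiag_shift// mixdiv_congdiag ?unitarymx_unit// => [|i].
  apply: eq_bigr => i _; rewrite rownormsq_unitary// mulr1.
  by rewrite opprD addrACA subrr addr0.
by rewrite gt_eqF// ltr_pwDl ?ltr_wpDl// mulr_ge0// addr_ge0// ltW.
Qed.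

Lemma chi2div_udiag e : 0 < e ->
  chi2div (congdiag P r + (e%:C)%:M) (congdiag P d + (e%:C)%:M) =
  \sum_i (r i - d i) ^+ 2 / (d i + e).
Proof.
move=> e0; rewrite !congdiag_shift// chi2div_congdiag ?unitarymx_unit// => [|i].
  apply: eq_bigr => i _; rewrite rownormsq_unitary// mulr1.
  by rewrite opprD addrACA subrr addr0.
by rewrite gt_eqF// ltr_wpDl.
Qed.

Lemma retr_density_udiag : retr (congdiag P r) = retr (congdiag P d).
Proof. by rewrite !(retr_udiag _ uP) r1 d1. Qed.

(** As the limit exists it can be computed along [e = 1 / (k + 1)], where the
    integrands increase with [k] and monotone convergence applies, including
    when the limit is [+oo]. *)
Lemma maxfdiv_udiag :
  maxfdiv f (congdiag P r) (congdiag P d) = repr_value r d f c lam.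
Proof.
have [c0 _ _] := frepr.
have prho := psdmx_congdiag P r0.
have psigma := psdmx_congdiag P d0.
have cS := is_cvg_maxfdiv prho psigma retr_density_udiag.
rewrite /maxfdiv; set F := (fun e : R => _) in cS *.
have h0 : (harmonic : R^nat) @ \oo --> (0 : R)^'+.
  have /cvgrPdist_lt hc := @cvg_harmonic R.
  move=> A [e /= e0 eA]; have := hc _ e0; apply: filterS => k.
  by move=> /eA; apply; exact: harmonic_gt0.
have cSh : F (harmonic k) @[k --> \oo] --> lim (F e @[e --> (0:R)^'+]).
  exact: (cvg_comp _ _ h0 cS).
rewrite -(cvg_lim _ cSh)//; apply: cvg_lim => //.
have -> : (fun k => F (harmonic k)) = (fun k =>
    (f 1 * (1 + harmonic k * n%:R))%:E +
    (c%:E * (\sum_i ((r i - d i) ^+ 2 / (d i + harmonic k))%:E) +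
    \int[lam]_(s in `[0%R, +oo[) \sum_i
      ((r i - d i) ^+ 2 * ((r i + harmonic k) + s * (d i + harmonic k))^-1)%:E))%E.
  apply/funext => k; have hk : 0 < harmonic k :> R by exact: harmonic_gt0.
  rewrite /F (maxfdiv_pd_shift prho psigma retr_density_udiag hk).
  rewrite (retr_udiag _ uP) d1 /quadratic_part (chi2div_udiag hk) sumEFin -EFinM.
  congr (_ + (_ + _))%E.
  apply: eq_integral => s; rewrite inE/= in_itv/= andbT => s0.
  by rewrite (mixdiv_udiag s0 hk) sumEFin.
have sq0 i : 0 <= (r i - d i) ^+ 2 by exact: sqr_ge0.
have hk0 k : 0 <= harmonic k :> R by exact: harmonic_ge0.
have hk_gt0 k : 0 < harmonic k :> R by exact: harmonic_gt0.
have den_gt0 s i k : 0 <= s -> 0 < (r i + harmonic k) + s * (d i + harmonic k).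
  by move=> s0; rewrite ltr_pwDl ?ltr_wpDl// mulr_ge0// addr_ge0.
have c_chi : (c%:E * (\sum_i ((r i - d i) ^+ 2 / (d i + harmonic k))%:E))%E
    @[k --> \oo] --> (c%:E * (\sum_i quoe ((r i - d i) ^+ 2)%R (d i)))%E.
  apply: cvgeZl => //; apply: cvg_nnesum => i _.
    by apply: nearW => k; rewrite lee_fin divr_ge0// addr_ge0.
  apply: cvg_quoe_regularized => //; [exact: nearW|exact: cvg_harmonic].
have c_int : (\int[lam]_(s in `[0%R, +oo[) (\sum_i
      ((r i - d i) ^+ 2 * ((r i + harmonic k) + s * (d i + harmonic k))^-1)%:E))%E
    @[k --> \oo] -->
    (\int[lam]_(s in `[0%R, +oo[) (\sum_i quoe ((r i - d i) ^+ 2)%R (r i + s * d i)%R))%E.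
  have lims (s : R) : 0 <= s -> (\sum_i
      ((r i - d i) ^+ 2 * ((r i + harmonic k) + s * (d i + harmonic k))^-1)%:E)%E
      @[k --> \oo] --> (\sum_i quoe ((r i - d i) ^+ 2)%R (r i + s * d i)%R)%E.
    move=> s0; apply: cvg_nnesum => i _; last exact: cvg_quoe_harmonic.
    by apply: nearW => k; rewrite lee_fin divr_ge0// ltW// den_gt0.
  rewrite [X in _ --> X](_ : _ = \int[lam]_(s in `[0%R, +oo[) limn (fun k => \sum_i
      ((r i - d i) ^+ 2 * ((r i + harmonic k) + s * (d i + harmonic k))^-1)%:E))%E;
    last first.
    apply: eq_integral => s; rewrite inE/= in_itv/= andbT => s0.
    by apply/esym/cvg_lim => //; exact: lims.
  apply: cvg_monotone_convergence => //.
  - move=> k; apply: emeasurable_sum => i.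
    apply/measurable_EFinP/measurable_funM; first exact: measurable_cst.
    by apply: measurable_inv_shift; rewrite ?ltr_wpDl ?addr_ge0.
  - move=> k s; rewrite /= in_itv/= andbT => s0; apply: sume_ge0 => i _.
    by rewrite lee_fin divr_ge0// ltW// den_gt0.
  move=> s; rewrite /= in_itv/= andbT => s0 k l kl; apply: lee_sum => i _.
  have hkl : harmonic l <= harmonic k :> R.
    by rewrite /harmonic /= lef_pV2 ?posrE// ler_nat.
  rewrite lee_fin ler_wpM2l// lef_pV2 ?posrE ?den_gt0//.
  by rewrite lerD ?lerD2l// ler_wpM2l// lerD2l.
have c_const : (f 1 * (1 + harmonic k * n%:R))%:E @[k --> \oo] --> (f 1)%:E.
  rewrite [X in _ --> X%:E](_ : _ = f 1 * (1 + 0 * n%:R)).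
    2: by rewrite mul0r addr0 mulr1.
  apply: cvg_EFin_comp; apply: cvgMl_tmp; apply: cvgD; first exact: cvg_cst.
  apply: cvgMr_tmp; exact: cvg_harmonic.
apply: cvgeD; [exact: fin_num_adde_defr|exact: c_const|].
apply: cvgeD; [|exact: c_chi|exact: c_int].
apply: ge0_adde_def; rewrite inE.
  by rewrite mule_ge0// ?lee_fin//; apply: sume_ge0 => i _; exact: quoe_ge0.
apply: integral_ge0 => s; rewrite /= in_itv/= andbT => s0.
exact: sum_quoe_ge0.
Qed.

End Aligned.

(** The inequality holds for each [e > 0], between the regularized states, whose
    eigenvalues [r i + e] and [d i + e] are positive and ordered as before. *)
Lemma maxfdiv_ge_udiag r d (P Q : 'M[R[i]]_n) : P \is unitarymx -> Q \is unitarymx ->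
    (forall i, 0 <= r i) -> (forall i, 0 <= d i) ->
    \sum_i r i = 1 -> \sum_i d i = 1 ->
    {homo r : i j / (i <= j)%N >-> j <= i} ->
    {homo d : i j / (i <= j)%N >-> j <= i} ->
  (maxfdiv f (congdiag P r) (congdiag P d) <= maxfdiv f (congdiag P r) (congdiag Q d))%E.
Proof.
move=> uP uQ r0 d0 r1 d1 homr homd; have [c0 _ _] := frepr.
have prho := psdmx_congdiag P r0.
have psigma := psdmx_congdiag P d0.
have psigmaQ := psdmx_congdiag Q d0.
have trP : retr (congdiag P r) = retr (congdiag P d) by rewrite !(retr_udiag _ uP) r1 d1.
have trQ : retr (congdiag P r) = retr (congdiag Q d).
  by rewrite (retr_udiag _ uP) (retr_udiag _ uQ) r1 d1.
apply: lee_lim; [exact: is_cvg_maxfdiv|exact: is_cvg_maxfdiv|].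
apply: filterS (nbhs_right_gt (0 : R)) => e e0.
rewrite [leLHS](maxfdiv_pd_shift prho psigma trP e0).
rewrite [leRHS](maxfdiv_pd_shift prho psigmaQ trQ e0).
rewrite -trP -trQ; apply: leeD2l.
have re0 i : 0 < r i + e by rewrite ltr_wpDl.
have de0 i : 0 < d i + e by rewrite ltr_wpDl.
have homre : {homo (fun i => r i + e) : i j / (i <= j)%N >-> j <= i}.
  by move=> i j /homr; rewrite lerD2r.
have homde : {homo (fun i => d i + e) : i j / (i <= j)%N >-> j <= i}.
  by move=> i j /homd; rewrite lerD2r.
have sub_e i : (r i + e) - (d i + e) = r i - d i by rewrite opprD addrACA subrr addr0.
apply: leeD.
  rewrite lee_fin (chi2div_udiag _ d0 uP e0).
  rewrite (congdiag_shift _ _ uP) (congdiag_shift _ _ uQ).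
  apply: ler_wpM2l => //.
  apply: le_trans (chi2div_ge uP uQ re0 de0 homre homde).
  by under [leRHS]eq_bigr do rewrite sub_e.
apply: ge0_le_integral => //.
- move=> s; rewrite /= in_itv/= andbT => s0; rewrite lee_fin.
  by apply: mixdiv_ge0 s0; exact: psdmx_shift_posdef.
- by apply: measurable_mixdiv; exact: psdmx_shift_posdef.
- by apply: measurable_mixdiv; exact: psdmx_shift_posdef.
move=> s; rewrite /= in_itv/= andbT => s0; rewrite lee_fin.
rewrite (mixdiv_udiag r0 d0 uP s0 e0) (congdiag_shift _ _ uP) (congdiag_shift _ _ uQ).
apply: le_trans (mixdiv_ge s0 uP uQ re0 de0 homre homde).
by under [leRHS]eq_bigr do rewrite sub_e.
Qed.

End Regularization.

(** * Decreasing eigenvalues and the minimum *)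

Section LambdaDown.
Variables (R : realType) (n : nat).
Implicit Types A Q : 'M[R[i]]_n.

Lemma diagonalized_congdiag Q A a : Q \is unitarymx ->
  Q^t* *m A *m Q = rdiag a -> A = congdiag (Q^t*) a.
Proof.
move=> /unitarymxP QQ QAQ; rewrite congdiagE -QAQ trmxCK !mulmxA QQ mul1mx.
by rewrite -mulmxA QQ mulmx1.
Qed.

Lemma eigenvalues_down_homo A :
  {homo (fun i : 'I_n => nth 0 (eigenvalues_down A) i) :
     i j / (i <= j)%N >-> j <= i}.
Proof.
have szA : size (eigenvalues_down A) = n.
  by rewrite /eigenvalues_down size_sort size_map size_enum_ord.
have srtA : sorted (fun x y : R => y <= x) (eigenvalues_down A).
  by apply: sort_sorted => x y; exact: le_total.
move=> i j; apply: (sorted_leq_nth _ _ 0 srtA); rewrite ?inE ?szA//.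
by move=> x y z yx zy; exact: le_trans zy yx.
Qed.

End LambdaDown.

Theorem theorem3p1 (R : realType) (n : nat) (f : R -> R)
    (c : R) (lam : {measure set (measurableTypeR R) -> \bar R})
    (rho sigma V W : 'M[R[i]]_n)
    (hf : operator_convex f) (hrepr : integral_repr f c lam)
    (hrho : density rho) (hsigma : density sigma)
    (hV : V \is unitarymx) (hW : W \is unitarymx)
    (hVrho : V^t* *m rho *m V = lambda_down rho)
    (hWsigma : W^t* *m sigma *m W = lambda_down sigma) :
  let unitaries : set 'M[R[i]]_n := [set U | U \is unitarymx] in
  let S (U : 'M[R[i]]_n) := maxfdiv f rho (U^t* *m sigma *m U) in
  is_min (S @` unitaries)
    (repr_maxfdiv f c lam (lambda_down rho) (lambda_down sigma)) /\
  argmin unitaries S (W *m V^t*).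
Proof.
move=> unitaries S.
pose r (i : 'I_n) := nth 0 (eigenvalues_down rho) i.
pose d (i : 'I_n) := nth 0 (eigenvalues_down sigma) i.
have [psrho trrho] := hrho; have [pssigma trsigma] := hsigma.
have uVt : V^t* \is unitarymx by rewrite trmxC_unitary.
have uWt : W^t* \is unitarymx by rewrite trmxC_unitary.
have rhoE : rho = congdiag (V^t*) r := diagonalized_congdiag hV hVrho.
have sigmaE : sigma = congdiag (W^t*) d := diagonalized_congdiag hW hWsigma.
have r0 : forall i, 0 <= r i.
  by move: psrho; rewrite rhoE; exact: psdmx_ge0 (unitarymx_unit uVt).
have d0 : forall i, 0 <= d i.
  by move: pssigma; rewrite sigmaE; exact: psdmx_ge0 (unitarymx_unit uWt).
have r1 : \sum_i r i = 1 by rewrite -(retr_udiag _ uVt) -rhoE /retr trrho.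
have d1 : \sum_i d i = 1 by rewrite -(retr_udiag _ uWt) -sigmaE /retr trsigma.
have SE U : S U = maxfdiv f (congdiag (V^t*) r) (congdiag (W^t* *m U) d).
  by rewrite /S rhoE sigmaE congdiag_congr.
clearbody S.
have uWV : W *m V^t* \is unitarymx := mul_unitarymx hW uVt.
have S_ge U : U \is unitarymx ->
    (maxfdiv f (congdiag (V^t*) r) (congdiag (V^t*) d) <= S U)%E.
  move=> uU; rewrite (SE U).
  exact: (maxfdiv_ge_udiag hrepr uVt (mul_unitarymx uWt uU) r0 d0 r1 d1
    (@eigenvalues_down_homo _ _ rho) (@eigenvalues_down_homo _ _ sigma)).
have S_min : S (W *m V^t*) = maxfdiv f (congdiag (V^t*) r) (congdiag (V^t*) d).
  by rewrite SE mulmxA (unitarymx_tCmul hW) mul1mx.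
split; last first.
  by split=> // _ [U uU <-]; rewrite S_min; exact: S_ge.
have reprE : repr_maxfdiv f c lam (lambda_down rho) (lambda_down sigma) = S (W *m V^t*).
  rewrite S_min (maxfdiv_udiag hrepr r0 d0 r1 d1 uVt).
  exact: (repr_maxfdivE r0 d0 hrepr r1 d1).
rewrite reprE; split; first by exists (W *m V^t*).
by move=> _ [U uU <-]; rewrite S_min; exact: S_ge.
Qed.
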